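(* Let $G$ be a nonelementary group of isometries of a separable hyperbolic metric space $X$, and let $S=S^{-1}$ be a finite generating set of $G$. Consider the non-backtracking random walk $w_n:=g_1g_2\cdots g_n$, where $g_1$ is uniform in $S$ and, for each $n\ge2$, $g_n$ is chosen uniformly at random among the elements of $S\setminus\{(g_{n-1})^{-1}\}$, and let $\mathbb P$ be the corresponding measure on the set of sample paths. Then $$\mathbb P\big(w_n\text{ is loxodromic on }X\big)\to1\quad\text{as }n\to\infty.$$
   Context: A hyperbolic space is a geodesic metric space $X$ for which there is $\delta\ge0$ such that each side of every geodesic triangle lies in the $\delta$-neighborhood of the other two sides; $\partial X$ is its Gromov boundary. An isometry $g$ is loxodromic if $\tau_X(g)=\lim_{n\to\infty}d(g^nx,x)/n>0$; two loxodromics are independent if their fixed point sets on $\partial X$ are disjoint. A group of isometries is nonelementary if it contains two independent loxodromics. *)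

(* Defs.v *)
From HB Require Import structures.
From mathcomp Require Import all_boot all_order all_algebra finmap.
From mathcomp Require Import all_classical all_reals all_analysis.

Set Implicit Arguments.
Unset Strict Implicit.
Unset Printing Implicit Defensive.

Import Order.TTheory GRing.Theory Num.Theory.
Import numFieldNormedType.Exports.

Local Open Scope classical_set_scope.
Local Open Scope ring_scope.

Section Hyperbolic.
Context {R : realType} (X : metricType R).
Implicit Types (x y z o p q : X) (A B C : set X).

Definition separable_space := exists D : set X, countable D /\ dense D.

Definition geodesic_path x y (c : R -> X) :=
  [/\ c 0 = x, c (mdist x y) = y &
      {in `[0, mdist x y] &, forall s t, mdist (c s) (c t) = `|s - t|}].

Definition geodesic_segment x y A :=
  exists2 c : R -> X, geodesic_path x y c & A = c @` `[0, mdist x y].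

Definition geodesic_space := forall x y, exists A, geodesic_segment x y A.

(* Only the side [x, y] is mentioned: the cyclic permutations of (x, y, z)
   give the other two sides. *)
Definition slim_triangles (delta : R) :=
  forall x y z A B C,
    geodesic_segment x y A -> geodesic_segment y z B ->
    geodesic_segment z x C ->
    forall p, A p -> exists2 q, (B `|` C) q & mdist p q <= delta.

Definition hyperbolic_space :=
  geodesic_space /\ exists2 delta : R, 0 <= delta & slim_triangles delta.

Definition gromov_product o x y : R :=
  (mdist x o + mdist y o - mdist x y) / 2.

(* (u_i | v_j)_o tends to infinity as i and j do. Whether this holds does not
   depend on the basepoint o. *)
Definition gromov_asymptotic (u v : nat -> X) :=
  forall o (M : R),
    \forall i \near \oo & j \near \oo, M <= gromov_product o (u i) (v j).

Definition gromov_sequence (u : nat -> X) := gromov_asymptotic u u.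

Definition gromov_class (u : nat -> X) : set (nat -> X) :=
  [set v | gromov_sequence v /\ gromov_asymptotic u v].

(* The space X need not be proper, so the boundary consists of classes of
   sequences converging to infinity rather than of classes of rays. *)
Definition gromov_boundary : set (set (nat -> X)) :=
  [set gromov_class u | u in gromov_sequence].

End Hyperbolic.

Section Isometry.
Context {R : realType} (X : metricType R).

Record Isom := MkIsom {
  isometry_fun :> X -> X;
  isometry_dist : forall x y,
    mdist (isometry_fun x) (isometry_fun y) = mdist x y;
  isometry_surj : forall y, exists x, isometry_fun x = y }.

Lemma isometry_ext (f g : Isom) : (forall x, f x = g x) -> f = g.
Proof.
case: f => f f1 f2; case: g => g g1 g2 /= /funext fg.
by case: _ / fg in g1 g2 *; congr MkIsom; exact: Prop_irrelevance.
Qed.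

HB.instance Definition _ := gen_eqMixin Isom.
HB.instance Definition _ := gen_choiceMixin Isom.

Lemma isometry_inj (f : Isom) : injective f.
Proof.
move=> x y fxy; apply: (@mdist_positivity R X).
by rewrite -(isometry_dist f) fxy mdistxx.
Qed.

Definition isometry_one : Isom.
Proof. by apply: (@MkIsom id) => // y; exists y. Defined.

Definition isometry_mul (f g : Isom) : Isom.
Proof.
apply: (@MkIsom (f \o g)) => [x y|z] /=.
  by rewrite !isometry_dist.
have [y <-] := isometry_surj f z; have [x <-] := isometry_surj g y.
by exists x.
Defined.

Definition isometry_preimage (f : Isom) (y : X) : X :=
  projT1 (cid (isometry_surj f y)).

Lemma isometry_preimageK (f : Isom) : cancel (isometry_preimage f) f.
Proof. by move=> y; rewrite /isometry_preimage; case: cid. Qed.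

Definition isometry_inv (f : Isom) : Isom.
Proof.
apply: (@MkIsom (isometry_preimage f)) => [x y|x].
  by rewrite -(isometry_dist f) !isometry_preimageK.
by exists (f x); apply: (@isometry_inj f); rewrite isometry_preimageK.
Defined.

Lemma isometry_mulA : associative isometry_mul.
Proof. by move=> f g h; exact: isometry_ext. Qed.

Lemma isometry_mul1 : left_id isometry_one isometry_mul.
Proof. by move=> f; exact: isometry_ext. Qed.

Lemma isometry_mulr1 : right_id isometry_one isometry_mul.
Proof. by move=> f; exact: isometry_ext. Qed.

Lemma isometry_mulV : left_inverse isometry_one isometry_inv isometry_mul.
Proof.
move=> f; apply: isometry_ext => x /=.
by apply: (@isometry_inj f); rewrite isometry_preimageK.
Qed.

Lemma isometry_mulrV : right_inverse isometry_one isometry_inv isometry_mul.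
Proof. by move=> f; apply: isometry_ext => x /=; rewrite isometry_preimageK. Qed.

HB.instance Definition _ := isGroup.Build Isom
  isometry_mulA isometry_mul1 isometry_mulr1 isometry_mulV isometry_mulrV.

Lemma isometry_mulE (f g : Isom) x : (f * g)%g x = f (g x).
Proof. by []. Qed.

Implicit Types (g h : Isom) (x : X).

(* The limit exists because d(g^n x, x) is subadditive in n, and its value
   does not depend on x. *)
Definition translation_length g x : R :=
  limn (fun n => mdist ((g ^+ n)%g x) x / n%:R).

Definition loxodromic g := exists x, 0 < translation_length g x.

Definition boundary_act g (xi : set (nat -> X)) : set (nat -> X) :=
  [set g \o u | u in xi].

Definition boundary_fixed g : set (set (nat -> X)) :=
  [set xi | gromov_boundary xi /\ boundary_act g xi = xi].

Definition independent g h := boundary_fixed g `&` boundary_fixed h = set0.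

Definition nonelementary (G : {pred Isom}) :=
  exists g h, [/\ g \in G, h \in G, loxodromic g, loxodromic h &
                  independent g h].

End Isometry.

Definition generates (T : groupType) (S : {fset T}) (G : {pred T}) :=
  {subset S <= G} /\
  forall H : {pred T}, group_closed H -> {subset S <= H} -> {subset G <= H}.

Section Walk.
Context {T : groupType} (S : {fset T}).

(* Indices start at 0: the increments g_1, g_2, ... of the walk are
   [g 0], [g 1], ..., and w_n is [walk g n]. The third clause says that,
   conditionally on the first n.+1 increments, the next one is uniform in S
   minus the inverse of the last one. The laws of all finite sequences of
   increments, hence the measure on sample paths, are thereby determined; the
   path space itself, with its coordinates for [g], is one possible [Omega]. *)
Definition nonbacktracking_increments {R : realType} {d : measure_display}
    {Omega : measurableType d} (P : probability Omega R)
    (g : nat -> Omega -> S) :=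
  [/\ forall n (s : S), measurable [set w | g n w = s],
      forall s : S, P [set w | g 0%N w = s] = ((#|` S|%:R : R)^-1)%:E &
      forall n (s : nat -> S) (t : S),
        let past := [set w | forall i, (i <= n)%N -> g i w = s i] in
        let allowed := (S `\ (val (s n))^-1%g)%fset in
        P (past `&` [set w | g n.+1 w = t]) =
        ((if val t \in allowed then (#|` allowed|%:R : R)^-1 else 0)%:E
          * P past)%E].

Definition walk {Omega : Type} (g : nat -> Omega -> S) (n : nat) (w : Omega)
    : T :=
  (\prod_(i < n) val (g i w))%g.

End Walk.

(* Main.v *)
Require Import Defs.
From mathcomp Require Import all_boot all_order all_algebra finmap.
From mathcomp Require Import all_classical all_reals all_analysis.
From mathcomp Require Import lra zify.

(** Why nonbacktracking walks become loxodromic.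

    Since [S] is closed under inversion, every letter has exactly [#|S| - 1]
    allowed successors, so the first increments of the walk form a uniformly
    distributed nonbacktracking word. The theorem says that almost all long
    nonbacktracking words have loxodromic values.

    The geometry enters through the length [d(o, x o)] of an isometry [x] and
    the associated Gromov products [(x | y)], which satisfy the four-point
    inequality ([four_point]). The basic tool is a local-to-global principle
    ([chain_gprod]): in a product of long elements whose consecutive Gromov
    products [(x^-1 | y)] are small compared with the lengths, almost nothing
    cancels. An isometry is loxodromic exactly when the length of its powers
    grows linearly ([loxodromicP]). Two independent loxodromics have powers
    [f1] and [f2] whose orbits are quasi-geodesics with pairwise different
    limits ([independent_straight]); conjugates of powers of [f2] by powers of
    [f1] give arbitrarily many long elements in pairwise different directions
    ([schottky_elements]).

    For every [n] this produces [n] Schottky words ([exists_schottky_words]).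
    They have the same length, the same first letter and the same last letter,
    and their values [f i] are long and have the property that, for any [z],
    both [(z | f i)] and [(z | (f i)^-1)] are large for at most one [i] each.
    Getting equal lengths is the delicate point: the words are the cyclic
    rotations of one product, which use the same factors in different orders.
    The local-to-global principle shows that for any [v] and [v'] the product
    [f i * v * f j * v'] is loxodromic for all but [4 n] of the [n ^ 2] pairs
    [(i, j)] ([two_blocks_count]).

    Cut a long random word into blocks of the appropriate length: with
    probability close to [1], at least two of them are Schottky words, each
    preceded by a connecting letter. Replacing one Schottky word by another
    keeps the word nonbacktracking, so given the rest of the word the two are
    independent and uniform. As being loxodromic is invariant under
    conjugation, the value of the word may be rotated to the form
    [f i * v * f j * v'], and it is loxodromic with conditional probability at
    least [1 - 4 / n] ([two_blocks_avg]). Since [n] is arbitrary, the theorem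
    follows. *)

Set Implicit Arguments.
Unset Strict Implicit.
Unset Printing Implicit Defensive.

Import Order.TTheory GRing.Theory Num.Theory.
Import numFieldNormedType.Exports.

Local Open Scope classical_set_scope.
Local Open Scope ring_scope.

(** * Gromov products of a length function on a group *)

Section LengthFunction.
Context {R : realType} {T : groupType}.

(** With [l x] the distance from a basepoint [o] to [x o], this is the Gromov
    product of [x o] and [y o] at [o]. *)
Definition gprod (l : T -> R) (x y : T) : R :=
  (l x + l y - l (x^-1 * y)%g) / 2.

(** The four-point inequality is stated as a disjunction rather than with a
    minimum, so that using it is a case analysis. *)
Record hyperbolic_length (delta : R) := HyperbolicLength {
  len :> T -> R;
  len1 : len 1%g = 0;
  lenV : forall x, len (x^-1)%g = len x;
  lenM : forall x y, len (x * y)%g <= len x + len y;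
  gprod_hyp : forall x y z,
    gprod len x y <= gprod len x z + delta \/
    gprod len y z <= gprod len x z + delta }.

End LengthFunction.

Section Chains.
Context {R : realType} {T : groupType} {delta : R}.
Variable (l : @hyperbolic_length R T delta).
Implicit Types (x y z : T) (s : seq T) (a : R).

Local Notation gp := (gprod l).

Lemma len_ge0 x : 0 <= l x.
Proof. by have := lenM l x (x^-1)%g; rewrite mulgV len1 lenV; lra. Qed.

Lemma gprodC x y : gp x y = gp y x.
Proof. by rewrite /gprod -[l (x^-1 * y)%g]lenV invgM invgK; lra. Qed.

Lemma gprod_ge0 x y : 0 <= gp x y.
Proof. by rewrite /gprod; have := lenM l (x^-1)%g y; rewrite lenV; lra. Qed.

Lemma gprod_le_len x y : gp x y <= l x.
Proof.
by rewrite /gprod; have := lenM l x (x^-1 * y)%g; rewrite mulVKg; lra.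
Qed.

Lemma gprod1 x : gp x 1%g = 0.
Proof. by rewrite /gprod mulg1 lenV len1; lra. Qed.

(** At the two ends of a segment, the Gromov products with a third point add up
    to the length of the segment. *)
Lemma gprod_mulr x y : gp x (x * y)%g = l x - gp (x^-1)%g y.
Proof. by rewrite /gprod mulKg lenV invgK; lra. Qed.

Lemma len_mul x y : l (x * y)%g = l x + l y - 2 * gp (x^-1)%g y.
Proof. by rewrite /gprod lenV invgK; lra. Qed.

Lemma gprod_perturb x y z : gp x y <= gp x (y * z)%g + l z.
Proof.
rewrite /gprod; have := lenM l (y * z)%g (z^-1)%g; rewrite mulgK lenV.
by have := lenM l (x^-1 * y)%g z; rewrite mulgA; lra.
Qed.

Lemma gprod_perturbl x y z : gp x y <= gp (x * z)%g y + l z.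
Proof. by rewrite !(gprodC _ y); exact: gprod_perturb. Qed.

Lemma gprod_translate z x y : gp x y <= gp (z * x)%g (z * y)%g + l z.
Proof.
rewrite /gprod invgM -mulgA mulKg.
have := lenM l (z^-1)%g (z * x)%g; have := lenM l (z^-1)%g (z * y)%g.
by rewrite !mulKg lenV; lra.
Qed.

Lemma delta_ge0 : 0 <= delta.
Proof. by have := gprod_hyp l 1 1 1; rewrite gprod1; case; lra. Qed.

Definition long a x := 2 * a + 4 * delta + 1 <= l x.

Definition corner a x y := gp (x^-1)%g y <= a.

(** The partial products of a chain form a local quasi-geodesic: its corners
    have Gromov product at most [a], and its steps are longer than [2 * a] by a
    margin that absorbs the errors [delta]. *)
Definition chain a s := all (long a) s && sorted (corner a) s.

Lemma chain_cons a x s : chain a (x :: s) -> chain a s.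
Proof.
by rewrite /chain /= => /andP[/andP[_ ->]]; exact: path_sorted.
Qed.

(** Local to global. Let [z] be the product of the factors after [y]. By
    induction [(y^-1 | z)] is small, so [y * z] starts in the direction of the
    long element [y]; the four-point inequality then bounds [(x^-1 | y * z)] by
    the corner [(x^-1 | y)] up to [delta]. *)
Lemma chain_gprod a x s : 0 <= a -> chain a (x :: s) ->
  gp (x^-1)%g (\prod_(y <- s) y)%g <= a + delta.
Proof.
move=> a0; have d0 := delta_ge0.
elim: s x => [|y s IHs] x cxs.
  by rewrite big_nil gprod1; lra.
have {IHs} := IHs y (chain_cons cxs); rewrite big_cons.
move: cxs; rewrite /chain /= /long /corner.
move=> /and3P[/and3P[_ yl _] xy _] IH.
have := gprod_hyp l (x^-1)%g (y * \prod_(z <- s) z)%g y.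
by rewrite (gprodC (y * _)%g) gprod_mulr; lra.
Qed.

Lemma chain_len_cons a x s : 0 <= a -> chain a (x :: s) ->
  l x - 2 * a - 2 * delta + l (\prod_(y <- s) y)%g
    <= l (\prod_(y <- x :: s) y)%g.
Proof. by move=> a0 /(chain_gprod a0); rewrite big_cons len_mul; lra. Qed.

Lemma chain_len a s : 0 <= a -> chain a s ->
  (size s)%:R <= l (\prod_(x <- s) x)%g.
Proof.
move=> a0; have d0 := delta_ge0; elim: s => [|x s IHs] cs.
  by rewrite big_nil len1.
have := IHs (chain_cons cs); have := chain_len_cons a0 cs.
move: cs => /andP[/andP[+ _] _]; rewrite /long /= -natr1; lra.
Qed.

Lemma prodg_rev_inv s :
  (\prod_(x <- rev ([seq (x^-1)%g | x <- s])) x = (\prod_(x <- s) x)^-1)%g.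
Proof. by rewrite -map_rev big_map prodgV revK. Qed.

Lemma chainV a s : chain a s -> chain a (rev ([seq (x^-1)%g | x <- s])).
Proof.
move=> /andP[sl sc]; apply/andP; split.
  rewrite all_rev all_map; apply: sub_all sl => x.
  by rewrite /long /= lenV.
rewrite rev_sorted sorted_map; apply: sub_sorted sc => x y.
by rewrite /corner /= invgK gprodC.
Qed.

Lemma chain_head a x s : 0 <= a -> chain a (x :: s) ->
  l x - a - delta <= gp x (\prod_(y <- x :: s) y)%g.
Proof. by move=> a0 /(chain_gprod a0); rewrite big_cons gprod_mulr; lra. Qed.

(** The product of a chain fellow-travels its first factor, so chains that
    start in different directions have products in different directions. *)
Lemma chain_separated a x y s s' : 0 <= a ->
  chain a (x :: s) -> chain a (y :: s') -> gp x y <= a ->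
  gp (\prod_(z <- x :: s) z)%g (\prod_(z <- y :: s') z)%g <= a + 2 * delta.
Proof.
move=> a0 cx cy xy; have d0 := delta_ge0.
have xh := chain_head a0 cx; have yh := chain_head a0 cy.
move: cx cy => /andP[/= /andP[xl _] _] /andP[/= /andP[yl _] _].
move: xl yl xh yh; rewrite /long.
set p := (\prod_(z <- x :: s) z)%g; set q := (\prod_(z <- y :: s') z)%g.
move=> xl yl xh yh.
have := gprod_hyp l x p y; have := gprod_hyp l p q y.
by rewrite (gprodC q y); lra.
Qed.

End Chains.

(** * Linear growth and straight elements *)

Section LinearGrowth.
Context {R : realType} {T : groupType} {delta : R}.
Variable (l : @hyperbolic_length R T delta).
Implicit Types (f g x y z u : T).

Local Notation gp := (gprod l).

Lemma len_expg_le x n : l (x ^+ n)%g <= n%:R * l x.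
Proof.
elim: n => [|n IHn]; first by rewrite expg0 len1 mul0r.
by rewrite expgS -natr1; have := lenM l x (x ^+ n)%g; lra.
Qed.

(** The additive constant makes the property invariant under conjugation and
    under a change of basepoint. *)
Definition linear_growth x :=
  exists c D : R, 0 < c /\ forall n, c * n%:R - D <= l (x ^+ n)%g.

Lemma linear_growth_mulC x y :
  linear_growth (x * y)%g -> linear_growth (y * x)%g.
Proof.
move=> [c [D [c0 xyD]]]; exists c, (D + 2 * l y); split=> // n.
have := xyD n.
have -> : ((x * y) ^+ n = y^-1 * (y * x) ^+ n * y)%g.
  have -> : (x * y = (y * x) ^ y)%g by rewrite conjgE !mulgA mulVg mul1g.
  by rewrite -conjXg conjgE mulgA.
have := lenM l (y^-1 * (y * x) ^+ n)%g y.
by have := lenM l (y^-1)%g ((y * x) ^+ n)%g; rewrite lenV; lra.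
Qed.

(** The powers of a straight element are products of chains, so its orbits are
    quasi-geodesics. *)
Definition straight f := exists a, [/\ 0 <= a, corner l a f f & long l a f].

Lemma straightV f : straight f -> straight (f^-1)%g.
Proof.
move=> [a [a0 cf lf]]; exists a; split=> //.
  by rewrite /corner invgK gprodC.
by rewrite /long lenV.
Qed.

(** The trace that independence leaves on lengths, without reference to the
    boundary. *)
Definition transverse f1 f2 := exists C, forall i j,
  [/\ gp (f1 ^+ i)%g (f2 ^+ j)%g <= C, gp (f1 ^- i)%g (f2 ^+ j)%g <= C,
      gp (f1 ^+ i)%g (f2 ^- j)%g <= C & gp (f1 ^- i)%g (f2 ^- j)%g <= C].

Lemma chain_nseq a f n : corner l a f f -> long l a f -> chain l a (nseq n f).
Proof.
move=> cf lf; rewrite /chain all_nseq lf orbT /=.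
by case: n => // n /=; elim: n => //= n ->; rewrite cf.
Qed.

Lemma prodg_nseq f n : (\prod_(x <- nseq n f) x = f ^+ n)%g.
Proof. by elim: n => [|n IHn]; rewrite ?big_nil// big_cons IHn expgS. Qed.

Lemma straight_len f n : straight f -> n%:R <= l (f ^+ n)%g.
Proof.
move=> [a [a0 cf lf]]; have := chain_len a0 (chain_nseq n cf lf).
by rewrite size_nseq prodg_nseq.
Qed.

(** Both half-orbits fellow-travel their first steps, and these form a
    corner. *)
Lemma straight_gprodV f : straight f ->
  exists C, forall k j, gp (f ^- k)%g (f ^+ j)%g <= C.
Proof.
have d0 := delta_ge0 l.
move=> [a [a0 cf lf]]; exists (a + 2 * delta) => -[|k] j.
  by rewrite invg1 gprodC gprod1; lra.
have := chain_gprod a0 (chain_nseq j.+1 cf lf); rewrite prodg_nseq => fj.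
have cf' : corner l a (f^-1)%g (f^-1)%g by rewrite /corner invgK gprodC.
have lf' : long l a (f^-1)%g by rewrite /long lenV.
have fk : l f - a - delta <= gp (f^-1)%g (f ^- k.+1)%g.
  rewrite -expVgn -prodg_nseq -(lenV l f).
  exact: chain_head a0 (chain_nseq k.+1 _ _).
move: lf; rewrite /long; have := gprod_hyp l (f^-1)%g (f ^- k.+1)%g (f ^+ j)%g.
lra.
Qed.

Lemma straight_gromov f : straight f ->
  exists C, forall k j, (k <= j)%N -> k%:R - C <= gp (f ^+ k)%g (f ^+ j)%g.
Proof.
move=> sf; have [C fC] := straight_gprodV sf; exists C => k j kj.
rewrite -(subnKC kj) expgnDr gprod_mulr.
by have := straight_len k sf; have := fC k (j - k)%N; lra.
Qed.

(** If no power of [g] were straight, then [g ^ (2 n)] would be longer than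
    [g ^ n] by less than [4 delta + 1] for all [n], so that the length of
    [g ^ (2 ^ k)] would grow at most linearly in [k], whereas it is at least
    linear in [2 ^ k]. *)
Lemma straight_power g : linear_growth g -> exists n, straight (g ^+ n)%g.
Proof.
move=> [c [D [c0 gD]]]; have d0 := delta_ge0 l.
pose B := 4 * delta + 1.
have [n gn] : exists n, l (g ^+ n)%g + B <= l (g ^+ (n + n))%g.
  apply/not_existsP => gn.
  have g2 k : l (g ^+ (2 ^ k))%g <= l g + k%:R * B.
    elim: k => [|k IHk]; first by rewrite expn0 expg1; lra.
    move/negP: (gn (2 ^ k)%N); rewrite -ltNge expnS mul2n -addnn -natr1; lra.
  pose A := l g + `|D|.
  have A0 : 0 <= A by rewrite addr_ge0 ?len_ge0.
  have [k kAB] : exists k : nat, (A + 2 * B) / c < k%:R.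
    by exists (Num.truncn ((A + 2 * B) / c)).+1; exact: truncnS_gt.
  (* Doubling the exponent makes the exponential dominate a quadratic. *)
  have k2 : k%:R * k%:R <= (2 ^ (k + k))%:R :> R.
    by rewrite -natrM ler_nat expnD leq_mul// ltnW// ltn_expl.
  have := g2 (k + k)%N; have := gD (2 ^ (k + k))%N.
  have k1 : 1 <= k%:R :> R.
    rewrite ler1n lt0n; apply/eqP => k0; move: kAB; rewrite k0 ltNge.
    by rewrite divr_ge0// ?(ltW c0)// /B; lra.
  move: kAB; rewrite ltr_pdivrMr// natrD => kAB.
  have := ler_norm D; rewrite /A in A0 kAB *.
  have : c * (k%:R * k%:R) <= c * (2 ^ (k + k))%:R by rewrite ler_pM2l.
  have : (l g + `|D| + 2 * B) * 1 <= (l g + `|D| + 2 * B) * k%:R.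
    by rewrite ler_wpM2l// /B; lra.
  have : (l g + `|D| + 2 * B) * k%:R < k%:R * c * k%:R.
    by rewrite ltr_pM2r//; lra.
  have : (l g + `|D|) * 1 <= (l g + `|D|) * k%:R by rewrite ler_wpM2l.
  by move: A0; rewrite /B; lra.
exists n, (gp (g ^- n)%g (g ^+ n)%g); split.
- exact: gprod_ge0.
- by rewrite /corner.
- by move: gn; rewrite /long expgnDr len_mul /B; lra.
Qed.

Definition alternating x y n := iter n (fun s => [:: x, y & s]) [::].

Lemma chain_alternating a x y n :
  corner l a x y -> corner l a y x -> long l a x -> long l a y ->
  chain l a (alternating x y n).
Proof.
move=> xy yx lx ly; rewrite /chain.
have -> /= : all (long l a) (alternating x y n).
  by elim: n => //= n ->; rewrite lx ly.
case: n => //= n; rewrite xy /=.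
by elim: n => //= n ->; rewrite yx xy.
Qed.

Lemma linear_growth_mul a x y : 0 <= a ->
  corner l a x y -> corner l a y x -> long l a x -> long l a y ->
  linear_growth (x * y)%g.
Proof.
move=> a0 xy yx lx ly; exists 2, 0; split=> // n.
have := chain_len a0 (chain_alternating n xy yx lx ly).
have -> : size (alternating x y n) = (2 * n)%N by elim: n => //= n ->; lia.
suff -> : (\prod_(z <- alternating x y n) z = (x * y) ^+ n)%g.
  by rewrite natrM; lra.
elim: n => [|n IHn] /=; first by rewrite big_nil.
by rewrite !big_cons IHn expgS mulgA.
Qed.

End LinearGrowth.

(** * From slim triangles to the four-point inequality *)

Section FourPoint.
Context {R : realType} {X : metricType R}.
Implicit Types (o x y z p q : X).

Local Notation d := (@mdist R X).

Lemma gromov_productC o x y : gromov_product o x y = gromov_product o y x.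
Proof. by rewrite /gromov_product (metric_sym x y) [X in X - _]addrC. Qed.

Lemma geodesic_segment_point x y A p :
  geodesic_segment x y A -> A p -> d x p + d p y = d x y.
Proof.
move=> [c [c0 c1 cd] ->] [t /= t01 <-]; have xy0 := mdist_ge0 x y.
suff cE (r : R) : 0 <= r <= d x y -> d x (c r) + d (c r) y = d x y.
  by apply: cE; move: t01; rewrite in_itv.
move=> /andP[r0 r1]; rewrite -{1}c0 -{1}c1.
rewrite !cd ?in_itv /= ?r0 ?r1 ?xy0 ?lexx// sub0r normrN ger0_norm//.
by rewrite distrC ger0_norm ?subr_ge0//; lra.
Qed.

Lemma gromov_product_le_segment o x y A p :
  geodesic_segment x y A -> A p -> gromov_product o x y <= d o p.
Proof.
move=> sA Ap; have := geodesic_segment_point sA Ap; rewrite /gromov_product.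
have := metric_triangle x p o; have := metric_triangle y p o.
by rewrite (metric_sym p o) (metric_sym y p); lra.
Qed.

Variable (delta : R).
Hypothesis (delta0 : 0 <= delta) (geoX : geodesic_space X).
Hypothesis (slimX : slim_triangles X delta).

(** Walking from [x] to [z] in unit steps, some step leaves the
    neighbourhood of the side [o, x] and thereby enters that of [z, o]. A point
    close to both sides realizes the Gromov product up to an error. *)
Lemma segment_near_gromov_product o x z A : geodesic_segment x z A ->
  exists2 p, A p & d o p <= gromov_product o x z + 2 * delta + 1.
Proof.
move=> sA; have [B sB] := geoX z o; have [C sC] := geoX o x.
pose near D p := exists2 q, D q & d p q <= delta.
suff [p Ap [[q Cq pq] [r Br pr]]] : exists2 p, A p &
    near C p /\ exists2 r, B r & d p r <= delta + 1.
  exists p => //; rewrite /gromov_product.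
  have := geodesic_segment_point sA Ap; have := geodesic_segment_point sB Br.
  have := geodesic_segment_point sC Cq.
  have := metric_triangle o q p; have := metric_triangle o r p.
  have := metric_triangle x q p; have := metric_triangle z r p.
  rewrite !(metric_sym x o) !(metric_sym _ p) (metric_sym r o) (metric_sym q x).
  rewrite (metric_sym p z); lra.
have slim p : A p -> near B p \/ near C p.
  by move=> /(slimX sA sB sC)[q [Bq|Cq] pq]; [left|right]; exists q.
have zB : B z.
  have [c [c0 _ _] ->] := sB; exists 0 => //=.
  by rewrite in_itv /= lexx mdist_ge0.
have xC : C x.
  have [c [_ c1 _] ->] := sC; exists (d o x) => //=.
  by rewrite in_itv /= lexx mdist_ge0.
have [c [c0 c1 cd] defA] := sA.
have Ac (t : R) : 0 <= t -> t <= d x z -> A (c t).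
  by move=> t0 tz; rewrite defA; exists t => //=; rewrite in_itv /= t0.
pose P (k : nat) := k%:R <= d x z /\ near C (c k%:R).
have [k [kz kC] nPk] : exists2 k, P k & ~ P k.+1.
  apply: contrapT => nP; have {}nP k : P k.
    elim: k => [|k Pk]; last by apply: contrapT => nPk; apply: nP; exists k.
    split; first exact: mdist_ge0.
    by rewrite c0; exists x => //; rewrite mdistxx.
  have [+ _] := nP (Num.truncn (d x z)).+1.
  by rewrite leNgt truncnS_gt.
exists (c k%:R); first exact: Ac (ler0n _ _) kz.
split=> //.
have [k1z|k1z] := leP k.+1%:R (d x z).
  have [] := slim _ (Ac k.+1%:R (ler0n _ _) k1z); last first.
    by move=> k1C; case: nPk.
  move=> [q Bq qd]; exists q => //.
  apply: (le_trans (metric_triangle _ (c k.+1%:R) _)).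
  rewrite addrC lerD// cd ?in_itv /= ?ler0n ?kz ?k1z//.
  by rewrite -natr1 opprD addNKr normrN normr1.
exists z => //; rewrite -{1}c1 cd ?in_itv /= ?ler0n ?kz ?lexx ?mdist_ge0//.
move: k1z; rewrite distrC ger0_norm ?subr_ge0// -natr1 -ltrBlDl => /ltW k1z.
by apply: le_trans k1z _; rewrite lerDr.
Qed.

(** The Gromov product of two points at [o] is the distance from [o] to a
    segment between them, up to an error; slimness puts a point of [x, z] near
    one of the other two segments. *)
Lemma four_point o x y z :
  gromov_product o x y <= gromov_product o x z + (3 * delta + 1) \/
  gromov_product o y z <= gromov_product o x z + (3 * delta + 1).
Proof.
have [A sA] := geoX x z; have [B sB] := geoX z y; have [C sC] := geoX y x.
have [p Ap po] := segment_near_gromov_product o sA.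
have [q + pq] := slimX sA sB sC Ap; have := metric_triangle o p q.
move=> opq [Bq|Cq]; [right|left]; rewrite gromov_productC.
  by have := gromov_product_le_segment o sB Bq; lra.
by have := gromov_product_le_segment o sC Cq; lra.
Qed.

End FourPoint.

Lemma hyperbolic_four_point {R : realType} {X : metricType R} :
  hyperbolic_space X -> exists delta, forall o x y z : X,
    gromov_product o x y <= gromov_product o x z + delta \/
    gromov_product o y z <= gromov_product o x z + delta.
Proof.
move=> [gX [delta d0 sX]]; exists (3 * delta + 1) => o x y z.
exact: four_point.
Qed.

(** * Loxodromic isometries and linear growth *)

Section Fekete.
Context {R : realType} (a : nat -> R).
Hypothesis (a_ge0 : forall n, 0 <= a n).
Hypothesis (a_sub : forall m n, a (m + n)%N <= a m + a n).

Lemma subadditive_mul k m r : a (k * m + r)%N <= k%:R * a m + a r.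
Proof.
elim: k => [|k IHk]; first by rewrite mul0n mul0r add0n add0r.
rewrite mulSn -addnA -natr1 mulrDl mul1r.
by have := a_sub m (k * m + r); lra.
Qed.

(** The limit is the infimum of the quotients: divide [n] by an [m] whose
    quotient is nearly optimal. *)
Lemma fekete : cvgn (fun n => a n / n%:R).
Proof.
pose E := [set a n / n%:R | n in [set n | (0 < n)%N]].
have E0 : has_lbound E.
  by exists 0 => _ [n _ <-]; rewrite divr_ge0.
have Ei : has_inf E by split=> //; exists (a 1 / 1%:R); exists 1%N.
apply/cvg_ex; exists (inf E); apply/cvgrPdist_le => /= e e0.
have [_ [m m0 <-] me] := inf_adherent (divr_gt0 e0 (ltr0Sn R 1)) Ei.
pose A := m%:R * a 1 + a 0.
have A0 : 0 <= A by rewrite addr_ge0// mulr_ge0.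
near=> n.
have n0 : (0 < n)%N by near: n; exists 1%N.
have n0R : 0 < n%:R :> R by rewrite ltr0n.
have ln : inf E <= a n / n%:R by apply: ge_inf => //; exists n.
rewrite distrC ger0_norm ?subr_ge0// lerBlDl.
have m0R : 0 < m%:R :> R by rewrite ltr0n.
have an : a n <= n%:R * (a m / m%:R) + A.
  rewrite {1}(divn_eq n m); apply: le_trans (subadditive_mul _ _ _) _.
  apply: lerD.
    rewrite [leRHS]mulrCA [leRHS]mulrC ler_wpM2r//.
    by rewrite ler_pdivlMr// -natrM ler_nat leq_trunc_div.
  have := subadditive_mul (n %% m) 1 0; rewrite muln1 addn0 => /le_trans; apply.
  by rewrite lerD2r ler_wpM2r// ler_nat ltnW// ltn_mod.
have An : A <= n%:R * (e / 2).
  rewrite -ler_pdivrMr ?divr_gt0//; near: n.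
  exists (Num.truncn (A / (e / 2))).+1 => // k /= kA.
  by rewrite ltW// (lt_le_trans (truncnS_gt _))// ler_nat.
rewrite ler_pdivrMr//; apply: (le_trans an).
have : n%:R * (a m / m%:R) <= n%:R * (inf E + e / 2) by rewrite ler_wpM2l// ltW.
by rewrite mulrC; lra.
Unshelve. all: by end_near.
Qed.

End Fekete.

Section OrbitLength.
Context {R : realType} {X : metricType R} {delta : R}.
Hypothesis (four_pointX : forall o x y z : X,
    gromov_product o x y <= gromov_product o x z + delta \/
    gromov_product o y z <= gromov_product o x z + delta).
Implicit Types (o x y : X) (f g h : Isom X).

Local Notation d := (@mdist R X).

Lemma gprod_orbit o f g :
  gprod (fun h => d o (h o)) f g = gromov_product o (f o) (g o).
Proof.
rewrite /gprod /gromov_product !(metric_sym _ o); congr ((_ - _) / 2).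
by rewrite -(isometry_dist f o) -isometry_mulE mulVKg.
Qed.

Definition orbit_length o : @hyperbolic_length R (Isom X) delta.
Proof.
apply: (@HyperbolicLength _ _ _ (fun h : Isom X => d o (h o))).
- exact: mdistxx.
- move=> f; rewrite metric_sym -(isometry_dist f ((f^-1)%g o)).
  by rewrite -(isometry_mulE f) mulgV.
- move=> f g; rewrite isometry_mulE -(isometry_dist f o (g o)).
  exact: metric_triangle.
- by move=> f g h; rewrite !gprod_orbit; exact: four_pointX.
Defined.

Lemma translation_length_cvg g x :
  cvgn (fun n => d ((g ^+ n)%g x) x / n%:R).
Proof.
apply: (@fekete _ (fun n => d ((g ^+ n)%g x) x)) => [n|m n].
  exact: mdist_ge0.
rewrite expgnDr isometry_mulE addrC.
apply: le_trans (metric_triangle _ ((g ^+ m)%g x) _) _.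
by rewrite isometry_dist.
Qed.

(** The limit in the translation length exists by subadditivity, so its
    positivity is a linear lower bound on the orbit, and changing the basepoint
    costs a bounded error. *)
Lemma loxodromicP o g : loxodromic g <-> linear_growth (orbit_length o) g.
Proof.
split=> [[x]|[c [D [c0 cD]]]].
  set u := fun n => d ((g ^+ n)%g x) x / n%:R => t0.
  pose c := translation_length g x / 2.
  have c0 : 0 < c by rewrite divr_gt0.
  have ct : c < limn u by rewrite -[limn u]/(translation_length g x) /c; lra.
  have /= [N _ Nu] := cvgr_gt _ (translation_length_cvg (g := g) (x := x)) _ ct.
  exists c, (c * N%:R + 2 * d o x); split=> // n /=.
  have gx : d ((g ^+ n)%g x) x <= 2 * d o x + d o ((g ^+ n)%g o).
    have := metric_triangle ((g ^+ n)%g x) ((g ^+ n)%g o) x.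
    rewrite isometry_dist; have := metric_triangle ((g ^+ n)%g o) o x.
    by rewrite (metric_sym x o) (metric_sym _ o); lra.
  have cN : 0 <= c * N%:R by rewrite mulr_ge0// ltW.
  case: (leqP N n) => Nn; last first.
    have : c * n%:R <= c * N%:R by rewrite ler_pM2l// ler_nat ltnW.
    by have := mdist_ge0 o x; have := mdist_ge0 o ((g ^+ n)%g o); lra.
  case: n => [|n] in Nn gx *.
    have := mdist_ge0 o x; have := mdist_ge0 o ((g ^+ 0)%g o); lra.
  have := Nu _ Nn; rewrite /= ltr_pdivlMr; last by rewrite ltr0n.
  by lra.
exists o; apply: (@lt_le_trans _ _ (c / 2)); first by rewrite divr_gt0.
apply: limr_ge; first exact: translation_length_cvg.
near=> n.
have n0 : 0 < n%:R :> R by rewrite ltr0n; near: n; exists 1%N.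
rewrite ler_pdivlMr// metric_sym; have /= := cD n.
suff : D <= c / 2 * n%:R by lra.
rewrite mulrC -ler_pdivrMr ?divr_gt0//; near: n.
exists (Num.truncn (D / (c / 2))).+1 => // k /= kA.
by rewrite ltW// (lt_le_trans (truncnS_gt _))// ler_nat.
Unshelve. all: by end_near.
Qed.

End OrbitLength.

(** * Fixed points on the boundary and independence *)

Section BoundaryFixedPoints.
Context {R : realType} {X : metricType R} {delta : R}.
Hypothesis (four_pointX : forall o x y z : X,
    gromov_product o x y <= gromov_product o x z + delta \/
    gromov_product o y z <= gromov_product o x z + delta).
Implicit Types (o x y : X) (f g h : Isom X) (u v w : nat -> X).

Local Notation d := (@mdist R X).
Local Notation L o := (orbit_length four_pointX o).

(** A change of basepoint moves Gromov products by a bounded amount, so a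
    single basepoint is enough. *)
Lemma gromov_asymptoticP o u v : gromov_asymptotic u v <->
  forall M, exists N, forall i j, (N <= i)%N -> (N <= j)%N ->
    M <= gromov_product o (u i) (v j).
Proof.
split=> [uv M|uv o' M].
  have [[A B] /= [[m _ mA] [n _ nB]] AB] := uv o M.
  exists (maxn m n) => i j; rewrite !geq_max => /andP[mi _] /andP[_ nj].
  by apply: (AB (i, j)); split; [exact: mA|exact: nB].
have [N NM] := uv (M + d o o').
exists ([set i | (N <= i)%N], [set j | (N <= j)%N]) => /=.
  by split; exists N.
move=> [i j] /= [Ni Nj]; have := NM i j Ni Nj; rewrite /gromov_product.
have := metric_triangle (u i) o' o; have := metric_triangle (v j) o' o.
by rewrite (metric_sym o' o); lra.
Qed.

Lemma gromov_asymptotic_sym u v :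
  gromov_asymptotic u v -> gromov_asymptotic v u.
Proof.
move=> uv; pose o := u 0; apply/(gromov_asymptoticP o) => M.
have [N NM] := (gromov_asymptoticP o u v).1 uv M.
by exists N => i j Ni Nj; rewrite gromov_productC; exact: NM.
Qed.

Lemma gromov_asymptotic_trans v u w :
  gromov_asymptotic u v -> gromov_asymptotic v w -> gromov_asymptotic u w.
Proof.
move=> uv vw; pose o := u 0; apply/(gromov_asymptoticP o) => M.
have [m mM] := (gromov_asymptoticP o u v).1 uv (M + delta).
have [n nM] := (gromov_asymptoticP o v w).1 vw (M + delta).
exists (maxn m n) => i j; rewrite !geq_max => /andP[mi _] /andP[_ nj].
have := mM i (maxn m n) mi (leq_maxl _ _).
have := nM (maxn m n) j (leq_maxr _ _) nj.
by have := four_pointX o (u i) (v (maxn m n)) (w j); lra.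
Qed.

Lemma gromov_asymptotic_isometry g u v :
  gromov_asymptotic u v -> gromov_asymptotic (g \o u) (g \o v).
Proof.
move=> uv o M; have [[A B] /= fAB sAB] := uv ((g^-1)%g o) M.
have go x : d (g x) o = d x ((g^-1)%g o).
  by rewrite -(isometry_dist g x) -(isometry_mulE g) mulgV.
exists (A, B) => // -[i j] /= ABij; have := sAB (i, j) ABij.
by rewrite /gromov_product /= !go isometry_dist.
Qed.

Lemma gromov_class_eq u v :
  gromov_asymptotic u v -> gromov_class u = gromov_class v.
Proof.
move=> uv; apply/seteqP; split=> w [ww uw]; split=> //.
  exact: gromov_asymptotic_trans (gromov_asymptotic_sym uv) uw.
exact: gromov_asymptotic_trans uv uw.
Qed.

(** Both [g] and its inverse map the sequence [u] into its own class, hence the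
    whole class into itself. *)
Lemma boundary_fixed_class g u : gromov_sequence u ->
  gromov_asymptotic u (g \o u) -> boundary_fixed g (gromov_class u).
Proof.
move=> uu ugu; split; first by exists u.
have ugVu : gromov_asymptotic u ((g^-1)%g \o u).
  apply: gromov_asymptotic_sym.
  have := gromov_asymptotic_isometry (g^-1)%g ugu.
  suff -> : (g^-1)%g \o (g \o u) = u by [].
  by apply/funext => n; rewrite /comp -(isometry_mulE (g^-1)%g) mulVg.
have fclass f v : gromov_asymptotic u (f \o u) -> gromov_class u v ->
    gromov_class u (f \o v).
  move=> ufu [vv uv]; split; first exact: gromov_asymptotic_isometry.
  exact: gromov_asymptotic_trans ufu (gromov_asymptotic_isometry _ uv).
apply/seteqP; split=> [_ [v uv <-]|v uv]; first exact: fclass.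
exists ((g^-1)%g \o v); first exact: fclass.
by apply/funext => n; rewrite /comp -(isometry_mulE g) mulgV.
Qed.

Lemma straight_gromov_sequence o f : straight (L o) f ->
  gromov_sequence (fun n => (f ^+ n)%g o).
Proof.
move=> sf; have [C fC] := straight_gromov sf.
apply/(gromov_asymptoticP o) => M; exists (Num.truncn (M + C)).+1 => i j.
wlog ij : i j / (i <= j)%N.
  move=> W Ni Nj; case/orP: (leq_total i j) => [/W|/W]; first exact.
  by rewrite gromov_productC; exact.
move=> Ni Nj; have := fC i j ij; rewrite gprod_orbit.
have : M + C < i%:R by rewrite (lt_le_trans (truncnS_gt _))// ler_nat.
by lra.
Qed.

(** Since [g] commutes with [f], it displaces all points of the orbit by the
    same distance, which does not change the limit. *)
Lemma straight_boundary_fixed o f g : straight (L o) f -> commute g f ->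
  boundary_fixed g (gromov_class (fun n => (f ^+ n)%g o)).
Proof.
move=> sf gf; apply: boundary_fixed_class.
  exact: straight_gromov_sequence.
apply/(gromov_asymptoticP o) => M.
have [N NM] := (gromov_asymptoticP o _ _).1 (straight_gromov_sequence sf)
  (M + L o g).
exists N => i j Ni Nj; have := NM i j Ni Nj.
rewrite /= -isometry_mulE (commuteX j gf) -!gprod_orbit.
by have := gprod_perturb (L o) (f ^+ i)%g (f ^+ j)%g g; rewrite /=; lra.
Qed.

(** One very large product [(f1 ^ m | f2 ^ n)] makes all [(f1 ^ i | f2 ^ j)]
    with [i] and [j] large, because each orbit converges. If there were
    arbitrarily large products, the two orbits would thus have the same limit,
    a fixed point of both [g] and [h]. *)
Lemma independent_gprod o f1 f2 g h :
  straight (L o) f1 -> straight (L o) f2 -> commute g f1 -> commute h f2 ->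
  independent g h ->
  exists C, forall m n, gprod (L o) (f1 ^+ m)%g (f2 ^+ n)%g <= C.
Proof.
move=> s1 s2 gf hf ind; apply: contrapT => unb.
suff ff : gromov_asymptotic (fun n => (f1 ^+ n)%g o) (fun n => (f2 ^+ n)%g o).
  have := straight_boundary_fixed s2 hf; rewrite -(gromov_class_eq ff) => h2.
  have : (boundary_fixed g `&` boundary_fixed h)
      (gromov_class (fun n => (f1 ^+ n)%g o)).
    by split=> //; exact: straight_boundary_fixed.
  by rewrite ind.
apply/(gromov_asymptoticP o) => M.
have [N1 N1M] := (gromov_asymptoticP o _ _).1 (straight_gromov_sequence s1)
  (M + 2 * delta).
have [N2 N2M] := (gromov_asymptoticP o _ _).1 (straight_gromov_sequence s2)
  (M + 2 * delta).
pose N := maxn N1 N2.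
have d0 := delta_ge0 (L o).
have N0 : 0 <= N%:R * (L o f1 + L o f2).
  by rewrite mulr_ge0// addr_ge0// len_ge0.
pose C := `|M| + 2 * delta + N%:R * (L o f1 + L o f2).
(* Above [C] both exponents are large, since small powers are short. *)
have [m [n mnC]] : exists m n, C < gprod (L o) (f1 ^+ m)%g (f2 ^+ n)%g.
  apply: contrapT => bnd; apply: unb; exists C => m n.
  by rewrite leNgt; apply/negP => mnC; apply: bnd; exists m, n.
have long_enough f k : L o f <= L o f1 + L o f2 ->
    C < L o (f ^+ k)%g -> (N <= k)%N.
  move=> f12; rewrite [(N <= k)%N]leqNgt => Ck; apply/negP => kN; move: Ck.
  apply/negP; rewrite -leNgt; apply: le_trans (len_expg_le _ _ _) _.
  have : k%:R * L o f <= N%:R * (L o f1 + L o f2).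
    by rewrite ler_pM ?len_ge0// ler_nat ltnW.
  by have := normr_ge0 M; rewrite /C; lra.
have Nm : (N <= m)%N.
  apply: (long_enough f1); first by rewrite lerDl len_ge0.
  exact: lt_le_trans mnC (gprod_le_len _ _ _).
have Nn : (N <= n)%N.
  apply: (long_enough f2); first by rewrite lerDr len_ge0.
  by rewrite gprodC in mnC; exact: lt_le_trans mnC (gprod_le_len _ _ _).
have MC : M + 2 * delta <= C by have := ler_norm M; rewrite /C; lra.
have [N1m N2n] : (N1 <= m)%N /\ (N2 <= n)%N by move: Nm Nn; rewrite /N; lia.
exists N => i j; rewrite !geq_max => /andP[N1i _] /andP[_ N2j].
have := N1M i m N1i N1m; have := N2M n j N2n N2j; move: mnC.
rewrite gprod_orbit.
have := four_pointX o ((f1 ^+ i)%g o) ((f1 ^+ m)%g o) ((f2 ^+ j)%g o).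
have := four_pointX o ((f1 ^+ m)%g o) ((f2 ^+ n)%g o) ((f2 ^+ j)%g o).
by lra.
Qed.

Lemma independent_straight o g h :
  loxodromic g -> loxodromic h -> independent g h ->
  exists m n, let f1 := (g ^+ m)%g in let f2 := (h ^+ n)%g in
    [/\ straight (L o) f1, straight (L o) f2 & transverse (L o) f1 f2].
Proof.
move=> /(loxodromicP four_pointX o)/straight_power[m s1].
move=> /(loxodromicP four_pointX o)/straight_power[n s2] ind.
exists m, n; set f1 := (g ^+ m)%g in s1 *; set f2 := (h ^+ n)%g in s2 *.
have cg : commute g f1 by exact/commuteX/commute_refl.
have ch : commute h f2 by exact/commuteX/commute_refl.
have [s1V s2V] := (straightV s1, straightV s2).
have [C1 C1P] := independent_gprod s1 s2 cg ch ind.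
have [C2 C2P] := independent_gprod s1V s2 (commuteV cg) ch ind.
have [C3 C3P] := independent_gprod s1 s2V cg (commuteV ch) ind.
have [C4 C4P] := independent_gprod s1V s2V (commuteV cg) (commuteV ch) ind.
split=> //; exists (`|C1| + `|C2| + `|C3| + `|C4|) => i j.
have := (normr_ge0 C1, normr_ge0 C2, normr_ge0 C3, normr_ge0 C4).
have := (ler_norm C1, ler_norm C2, ler_norm C3, ler_norm C4).
have := C1P i j; have := C2P i j; have := C3P i j; have := C4P i j.
rewrite !expVgn => ? ? ? ? [[[? ?] ?] ?] [[[? ?] ?] ?].
by split; lra.
Qed.

End BoundaryFixedPoints.

(** * Schottky families of group elements *)

Lemma group_closed_expg {T : groupType} {G : {pred T}} (x : T) k :
  group_closed G -> x \in G -> (x ^+ k)%g \in G.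
Proof.
move=> G_group xG; elim: k => [|k IHk]; first by rewrite expg0; case: G_group.
by rewrite expgS; exact: group_closedM G_group _ _ xG IHk.
Qed.

Section Transverse.
Context {R : realType} {T : groupType} {delta : R}.
Variable (l : @hyperbolic_length R T delta).
Implicit Types (f g x y z u : T).

Local Notation gp := (gprod l).

Lemma gprod_conj x y z u :
  gp (x * y * x^-1)%g (z * u * z^-1)%g
    <= gp y (x^-1 * z * u)%g + 2 * l x + l z.
Proof.
have := gprod_perturbl l (x * y * x^-1)%g (z * u * z^-1)%g x.
have := gprod_perturb l (x * y)%g (z * u * z^-1)%g z.
have := gprod_translate l (x^-1)%g (x * y)%g (z * u)%g.
by rewrite !mulgVK mulKg !mulgA lenV; lra.
Qed.

(** Premultiplication by [x] sends [z] to the direction of [x], which is away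
    from [y]. *)
Lemma gprod_detour C x y z : 2 * C + delta < l x ->
  gp x y <= C -> gp (x^-1)%g z <= C -> gp y (x * z)%g <= C + delta.
Proof.
have := gprod_hyp l y (x * z)%g x; rewrite (gprodC l y x).
by rewrite (gprodC l (x * z)%g) gprod_mulr; lra.
Qed.

(** The elements [f1 ^ (j n) * f2 ^ m * f1 ^ - (j n)] and their inverses go, up
    to a bounded error, in the directions of [f1 ^ (j n) * f2 ^ (+- m)], and
    these are pairwise different once [f1 ^ n] is long. The order of the
    quantifiers matters: [C] depends on [n] but not on [m], which makes the
    elements as long as desired. *)
Lemma schottky_elements f1 f2 J :
  straight l f1 -> straight l f2 -> transverse l f1 f2 ->
  exists C, forall B, exists m n,
    let t j := (f1 ^+ (j * n) * f2 ^+ m * f1 ^- (j * n))%g in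
    forall j, (j < J)%N -> B <= l (t j) /\
      forall k, (k < J)%N -> j != k ->
      gp (t j) (t k) <= C /\ gp (t j)^-1%g (t k)^-1%g <= C.
Proof.
move=> s1 s2 [C0 C0P].
pose n := (Num.truncn (2 * C0 + delta)).+1.
have nC0 : 2 * C0 + delta < n%:R by rewrite truncnS_gt.
(* [D] bounds all conjugating elements, independently of [m]. *)
pose D := (J * n)%:R * l f1.
have D0 : 0 <= D by rewrite mulr_ge0// len_ge0.
have lD j : (j < J)%N -> l (f1 ^+ (j * n))%g <= D.
  move=> jJ; apply: le_trans (len_expg_le _ _ _) _.
  by rewrite ler_wpM2r ?len_ge0// ler_nat leq_mul2r (ltnW jJ) orbT.
exists (C0 + delta + 3 * D) => B.
exists (Num.truncn (B + 2 * D)).+1, n => t j jJ.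
set m := (Num.truncn _).+1 in t *.
have mB : B + 2 * D < m%:R by rewrite truncnS_gt.
split=> [|k kJ].
  have := lenM l (t j) (f1 ^+ (j * n))%g; rewrite mulgVK.
  have := lenM l (f1 ^- (j * n))%g (f1 ^+ (j * n) * f2 ^+ m)%g; rewrite mulKg.
  by have := straight_len m s2; have := lD j jJ; rewrite lenV; lra.
have tV i : (t i)^-1%g = (f1 ^+ (i * n) * f2 ^- m * f1 ^- (i * n))%g.
  by rewrite /t !invgM invgK mulgA.
wlog jk : j k jJ kJ / (j < k)%N.
  move=> W; rewrite neq_ltn => /orP[jk|kj].
    by apply: W => //; rewrite neq_ltn jk.
  rewrite (gprodC l (t j)) (gprodC l (t j)^-1)%g; apply: W => //.
  by rewrite neq_ltn kj.
have lx : 2 * C0 + delta < l (f1 ^+ ((k - j) * n))%g.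
  apply: lt_le_trans (straight_len _ s1); apply: lt_le_trans nC0 _.
  by rewrite ler_nat leq_pmull// subn_gt0.
have xE : (f1 ^- (j * n) * f1 ^+ (k * n) = f1 ^+ ((k - j) * n))%g.
  by rewrite -{1}(subnKC (ltnW jk)) mulnDl expgnDr mulKg.
have ljk := (lD j jJ, lD k kJ).
move=> _; split; rewrite ?tV /t.
  have := gprod_conj (f1 ^+ (j * n)) (f2 ^+ m) (f1 ^+ (k * n)) (f2 ^+ m).
  have [c1 c2 _ _] := C0P ((k - j) * n)%N m; have := gprod_detour lx c1 c2.
  by rewrite xE; case: ljk; lra.
have := gprod_conj (f1 ^+ (j * n)) (f2 ^- m) (f1 ^+ (k * n)) (f2 ^- m).
have [_ _ c1 c2] := C0P ((k - j) * n)%N m; have := gprod_detour lx c1 c2.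
by rewrite xE; case: ljk; lra.
Qed.

(** The commutator of two large powers is the product of a chain of four
    elements, so it has positive length. The exponents are even because the
    elements of an infinite dihedral group need not commute, but their squares
    do. *)
Lemma transverse_not_commute f1 f2 :
  straight l f1 -> straight l f2 -> transverse l f1 f2 ->
  exists n, ~ commute (f1 ^+ (n * 2))%g (f2 ^+ (n * 2))%g.
Proof.
move=> s1 s2 [C0 C0P]; have d0 := delta_ge0 l.
pose a := `|C0|; have a0 : 0 <= a := normr_ge0 _.
pose n := (Num.truncn (2 * a + 4 * delta + 1)).+1.
exists n; set x := (f1 ^+ _)%g; set y := (f2 ^+ _)%g => xy.
have na : 2 * a + 4 * delta + 1 <= (n * 2)%:R.
  apply: ltW; apply: lt_le_trans (truncnS_gt _) _.
  by rewrite -/n ler_nat leq_pmulr.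
have lx : long l a x by apply: le_trans na (straight_len _ s1).
have ly : long l a y by apply: le_trans na (straight_len _ s2).
have C0a := ler_norm C0.
have [c1 c2 c3 c4] := C0P (n * 2)%N (n * 2)%N.
have c : chain l a [:: x; y; x^-1; y^-1]%g.
  move: lx ly; rewrite /chain /= /long /corner !lenV => -> ->.
  rewrite !invgK (gprodC _ (y^-1)%g) /= andbT.
  by apply/and3P; split; apply: le_trans C0a.
have := chain_len a0 c; rewrite !big_cons big_nil mulg1 mulgA xy /=.
have -> : (y * x * (x^-1 * y^-1) = 1)%g by rewrite mulgA mulgK mulgV.
by rewrite len1 lern0.
Qed.

End Transverse.

(** * Reduced words and small generating sets *)

Section DoubleCentralizer.
Context {T : groupType}.
Implicit Types (x y z a b c : T).

(** The double centralizer of [z] is an abelian subgroup containing [z]. *)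
Definition dcent z x := forall y, commute z y -> commute x y.

Lemma dcentV z x : dcent z x -> dcent z (x^-1)%g.
Proof. by move=> zx y /zx /commute_sym/commuteV/commute_sym. Qed.

Lemma dcentM z x y : dcent z x -> dcent z y -> dcent z (x * y)%g.
Proof.
by move=> zx zy u zu; apply/commute_sym/commuteM; apply/commute_sym; auto.
Qed.

Lemma dcent1 z : dcent z 1%g.
Proof. by move=> y _; exact/commute_sym/commute1. Qed.

Lemma dcent_commute z x y : dcent z x -> dcent z y -> commute x y.
Proof. by move=> zx zy; apply/zx/commute_sym/zy. Qed.

Lemma commute_conjg a x y : commute x y -> commute (x ^ a)%g (y ^ a)%g.
Proof. by rewrite /commute -!conjMg => ->. Qed.

Lemma dcent_conjg z a x : (z ^ a = z^-1)%g ->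
  dcent z x -> dcent z (x ^ a)%g.
Proof.
move=> za zx y zy; rewrite -[y](conjgKV a); apply/commute_conjg/zx.
have zE : (z = (z ^ a^-1)^-1)%g by rewrite -conjVg -za conjgK.
by rewrite zE; apply/commute_sym/commuteV/commute_sym/commute_conjg.
Qed.

(** Conjugation by the involution [a] inverts [a * b], so the double centralizer
    of [a * b] together with its coset by [a] is a group. *)
Lemma dihedral_dcent_div a b x y : (a^-1 = a)%g -> (b^-1 = b)%g ->
  let H u := dcent (a * b)%g u \/ dcent (a * b)%g (u * a)%g in
  H x -> H y -> H (x / y)%g.
Proof.
move=> aV bV H; set z := (a * b)%g in H *.
have aa : (a * a = 1)%g by rewrite -{1}aV mulVg.
have za : (z ^ a = z^-1)%g by rewrite conjgE /z invgM aV bV !mulgA aa mul1g.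
have cE u : (u ^ a = a * u * a)%g by rewrite conjgE aV mulgA.
move=> [zx|zx] [zy|zy].
- by left; exact: dcentM (dcentV zy).
- right; rewrite -mulgA; apply: dcentM => //.
  have -> : (y^-1 * a = (y * a)^-1 ^ a)%g.
    by rewrite cE invgM aV !mulgA aa mul1g.
  exact/dcent_conjg/dcentV.
- right; have -> : (x / y * a = x * a * (y^-1 ^ a))%g.
    by rewrite cE !mulgA -[(x * a * a)%g]mulgA aa mulg1.
  exact/dcentM/dcent_conjg/dcentV.
- left; have -> : (x / y = x * a * (y * a)^-1)%g.
    by rewrite invgM aV !mulgA -[(x * a * a)%g]mulgA aa mulg1.
  exact/dcentM/dcentV.
Qed.

Lemma dihedral_dcent_sqr a b x : (a^-1 = a)%g -> (b^-1 = b)%g ->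
  dcent (a * b)%g x \/ dcent (a * b)%g (x * a)%g -> dcent (a * b)%g (x ^+ 2)%g.
Proof.
move=> aV bV [zx|zx]; rewrite expg2; first exact: dcentM.
have aa : (a * a = 1)%g by rewrite -{1}aV mulVg.
have za : ((a * b) ^ a = (a * b)^-1)%g.
  by rewrite conjgE invgM aV bV !mulgA aa mul1g.
have -> : (x * x = x * a * ((x * a) ^ a))%g.
  rewrite conjgE aV !mulgA -[(x * a * a)%g]mulgA aa mulg1.
  by rewrite -!mulgA aa mulg1.
exact/dcentM/dcent_conjg.
Qed.

End DoubleCentralizer.

Section Words.
Context {T : groupType} {S : {fset T}} {G : {pred T}}.
Hypothesis (S_generates : generates S G).
Hypothesis (S_symmetric : [fset (s^-1)%g | s in S]%fset = S).
Implicit Types (s t : S) (w : seq S) (x y : T).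

Lemma generates_ind (H : T -> Prop) : H 1%g ->
  (forall x y, H x -> H y -> H (x / y)%g) ->
  (forall s, H (val s)) -> forall x, x \in G -> H x.
Proof.
move=> H1 HD HS x xG; apply/asboolP.
have [_ /(_ [pred u | `[< H u >]])] := S_generates; apply=> //.
  by split=> [|u v]; rewrite !inE//; exact: HD.
by move=> u uS; rewrite inE; exact: HS [` uS]%fset.
Qed.

Lemma letterV s : (val s)^-1%g \in S.
Proof.
by have := valP s; move: (val s) => x xS; rewrite -S_symmetric in_imfset.
Qed.

(** At most two letters, closed under inversion, generate a cyclic group or a
    quotient of the infinite dihedral group. *)
Lemma squares_commute x y : (#|` S| <= 2)%N ->
  x \in G -> y \in G -> commute (x ^+ 2)%g (y ^+ 2)%g.
Proof.
move=> S2 xG yG.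
have [z zG] : exists z, forall u, u \in G -> dcent z (u ^+ 2)%g; last first.
  by apply: (@dcent_commute _ z); exact: zG.
have [a [b [Sab ab]]] : exists a b, (forall s, val s = a \/ val s = b) /\
    ((a^-1 = b)%g \/ ((a^-1 = a)%g /\ (b^-1 = b)%g)).
  case: (fset_0Vmem S) => [S0|[a aS]].
    exists 1%g, 1%g; split; last by left; rewrite invg1.
    by move=> [s sS]; exfalso; move: sS; rewrite S0 inE.
  have [b [bS Sab]] : exists b, b \in S /\ forall s, val s = a \/ val s = b.
    case: (fset_0Vmem (S `\ a)%fset) => [S0|[b bSa]].
      exists a; split=> // s; left; apply/eqP; rewrite -in_fset1.
      by apply: (fsubsetP _ _ (valP s)); rewrite -fsetD_eq0 S0.
    move: (bSa); rewrite in_fsetD1 => /andP[ba bS]; exists b; split=> // s.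
    have : val s \in (a |` [fset b])%fset; last first.
      by rewrite !inE => /orP[] /eqP; [left|right].
    have : [fset a; b]%fset = S.
      apply/eqP; rewrite eqEfcard cardfs2 eq_sym ba S2 andbT.
      by apply/fsubsetP => u; rewrite !inE => /orP[] /eqP ->.
    by move->; exact: valP.
  have [aV bV] := (letterV [` aS]%fset, letterV [` bS]%fset).
  exists a, b; split=> //.
  have [/= aVE|] := Sab [` aV]%fset; last by left.
  have [/= bVE|] := Sab [` bV]%fset; last by right.
  by left; rewrite -bVE invgK.
case: ab => [aV|[aV bV]].
  exists a => u uG; rewrite expg2.
  suff : dcent a u by move=> ?; exact: dcentM.
  apply: generates_ind uG => [|v w vd wd|s]; first exact: dcent1.
    exact/dcentM/dcentV.
  by case: (Sab s) => ->//; rewrite -aV; exact: dcentV.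
exists (a * b)%g => u uG; apply: dihedral_dcent_sqr => //.
pose H v := dcent (a * b)%g v \/ dcent (a * b)%g (v * a)%g.
apply: (@generates_ind H) uG => [|v w vd wd|s]; first by left; exact: dcent1.
  exact: dihedral_dcent_div.
have aa : (a * a = 1)%g by rewrite -{1}aV mulVg.
have ba : (b * a = (a * b)^-1)%g by rewrite invgM aV bV.
right; case: (Sab s) => ->; rewrite ?aa ?ba; first exact: dcent1.
exact: dcentV.
Qed.

Definition nonbacktracking : rel S := fun s t => val t != (val s)^-1%g.

Definition word_val w : T := (\prod_(s <- w) val s)%g.

Definition reduced_value x :=
  exists2 w, sorted nonbacktracking w & word_val w = x.

Lemma reduced_value_letter s x : reduced_value x -> reduced_value (val s * x)%g.
Proof.
move=> [[|t w] wr <-].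
  by exists [:: s]; rewrite // /word_val big_seq1 big_nil mulg1.
have [st|/negPn/eqP ts] := boolP (nonbacktracking s t).
  by exists [:: s, t & w]; rewrite ?/word_val ?big_cons //= st.
exists w; first exact: path_sorted wr.
by rewrite /word_val big_cons ts mulVKg.
Qed.

(** The elements whose translations preserve the set of values of reduced words
    form a group that contains the letters, hence [G]; they map the value [1] of
    the empty word to themselves. *)
Lemma reduced_word x : x \in G -> reduced_value x.
Proof.
move=> xG; rewrite -[x]mulg1.
suff H : forall y, reduced_value y <-> reduced_value (x * y)%g.
  by apply: (H 1%g).1; exists [::]; rewrite // /word_val big_nil.
apply: (@generates_ind (fun u => forall y, _ <-> _)) xG => [y|u v Hu Hv y|s y].
- by rewrite mul1g.
- by rewrite -mulgA -Hu (Hv (v^-1 * y)%g) mulVKg.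
split; first exact: reduced_value_letter.
move=> /(reduced_value_letter [` letterV s]%fset) /=.
by rewrite mulKg.
Qed.

End Words.

(** * Sparse relations and rotated products *)

Lemma sorted_distinct {A : eqType} (r : rel A) (s : seq A) : uniq s ->
  {in s &, forall x y, x != y -> r x y} -> sorted r s.
Proof.
case: s => //= x s; elim: s x => //= y s IHs x /andP[+ us] rs.
rewrite inE negb_or => /andP[xy _]; rewrite rs ?inE ?eqxx ?orbT//=.
by apply: IHs => // u v us' vs'; apply: rs; rewrite inE ?us' ?vs' orbT.
Qed.

Lemma pigeonhole_filter {A : eqType} {F : finType} (phi : A -> F) n
    (s : seq A) : (#|F| * n < size s)%N ->
  exists v, (n < size [seq x <- s | phi x == v])%N.
Proof.
move=> ns; apply: contrapT => nv.
have : size s = (\sum_(v : F) size [seq x <- s | phi x == v])%N.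
  elim: s {ns nv} => [|x s IHs] /=; first by rewrite big1.
  rewrite IHs (bigD1 (phi x)) //= [in RHS](bigD1 (phi x)) //= eqxx /=.
  rewrite addSn; congr (_ + _).+1.
  by apply: eq_bigr => v /negPf xv; rewrite eq_sym xv.
move=> sE; move: ns; rewrite sE ltnNge => /negP; apply.
rewrite -sum_nat_const; apply: leq_sum => v _.
by rewrite leqNgt; apply/negP => vs; apply: nv; exists v.
Qed.

(** If more than [n] elements are related to [x], then [x] is the only element
    that each of them is related to, so they are pairwise unrelated. Otherwise
    discard the few elements related to [x] in either direction, and induct. *)
Lemma sparse_independent {A : eqType} (bad : rel A) n (s : seq A) : uniq s ->
  {in s & &, forall x y z, bad x y -> bad x z -> y = z} ->
  (n * n.+2 <= size s)%N ->
  exists s', [/\ size s' = n, uniq s', {subset s' <= s} &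
    {in s' &, forall x y, x != y -> ~~ bad x y}].
Proof.
elim: n s => [|n IHn] s us badP ns; first by exists [::].
case: s => [|x s] // in us badP ns *.
have /andP[xs us'] := us.
pose inx := [seq y <- s | bad y x].
have [nin|nin] := leqP n.+1 (size inx).
  have sub : {subset take n.+1 inx <= s}.
    by move=> y /mem_take; rewrite mem_filter => /andP[].
  exists (take n.+1 inx); split.
  - by rewrite size_takel.
  - exact/take_uniq/filter_uniq.
  - by move=> y /sub ys; rewrite inE ys orbT.
  move=> y z yi zi yz; apply/negP => badyz.
  have := mem_take yi; rewrite mem_filter => /andP[badyx ys].
  have zs := sub z zi.
  have xz : x = z.
    by apply: (badP y); rewrite ?inE ?eqxx ?ys ?zs ?orbT.
  by move: xs; rewrite xz zs.
pose outx := [seq y <- s | bad x y].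
have out1 : (size outx <= 1)%N.
  have uo : uniq outx by exact: filter_uniq.
  case E : outx uo => [|y [|z t]] //=; rewrite !inE negb_or => /andP[].
  have [yo zo] : y \in outx /\ z \in outx by rewrite E !inE !eqxx !orbT.
  move: yo zo; rewrite !mem_filter => /andP[by1 ys] /andP[bz zs].
  have -> : y = z by apply: (badP x); rewrite ?inE ?eqxx ?ys ?zs ?orbT.
  by rewrite eqxx.
pose s2 := [seq y <- s | ~~ bad x y && ~~ bad y x].
have s2s : {subset s2 <= x :: s}.
  by move=> y; rewrite mem_filter inE => /andP[_ ->]; rewrite orbT.
have ss : (size s <= size s2 + size inx + size outx)%N.
  rewrite /s2 /inx /outx; elim: (s) => //= y t IHt.
  by case: (bad x y); case: (bad y x) => /=; lia.
have [||s' [ns' us2 ss' bads']] := IHn s2 (filter_uniq _ us').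
- by move=> u v w /s2s us2 /s2s vs2 /s2s ws2; exact: badP.
- move: ns nin out1 ss => /=; nia.
exists (x :: s'); split=> /=.
- by rewrite ns'.
- rewrite us2 andbT; apply/negP => /ss'; rewrite mem_filter => /andP[_].
  exact/negP.
- by move=> y; rewrite inE => /orP[/eqP ->|/ss'/s2s//]; rewrite inE eqxx.
move=> y z; rewrite !inE => /orP[/eqP ->|ys] /orP[/eqP ->|zs].
- by rewrite eqxx.
- by move: (ss' z zs); rewrite mem_filter => /andP[/andP[]].
- by move: (ss' y ys); rewrite mem_filter => /andP[/andP[]].
- exact: bads'.
Qed.

Section Rotations.
Context {R : realType} {T : groupType} {delta : R}.
Variable (l : @hyperbolic_length R T delta).
Context (X : nat -> T) (n : nat) (a : R).
Local Notation gp := (gprod l).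
Hypothesis (a0 : 0 <= a).
Hypothesis (X_long : forall i, (i < n)%N -> long l a (X i)).
Hypothesis (X_separated : forall i j, (i < n)%N -> (j < n)%N -> i != j ->
  [/\ corner l a (X i) (X j), gp (X i) (X j) <= a &
      gp (X i)^-1%g (X j)^-1%g <= a]).

(** All rotations of a product use the same factors, so they will spell words of
    the same length, but they begin and end with different factors. *)
Let rotation i := [seq X k | k <- rot i (iota 0 n)].

Lemma rotation_chain i : chain l a (rotation i).
Proof.
apply/andP; split.
  rewrite all_map; apply/allP => k; rewrite mem_rot mem_iota /= add0n.
  exact: X_long.
rewrite sorted_map; apply: sorted_distinct; first by rewrite rot_uniq iota_uniq.
move=> j k; rewrite !mem_rot !mem_iota /= !add0n => jn kn jk.
by have [] := X_separated jn kn jk.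
Qed.

Lemma rotation_head i : (i < n)%N -> exists s, rotation i = X i :: s.
Proof.
move=> i_n; rewrite /rotation /rot (drop_nth 0) ?size_iota// nth_iota//= add0n.
by eexists.
Qed.

Lemma rotation_last i : (i < n)%N -> exists s,
  rotation i = rcons s (X (if i == 0 then n.-1 else i.-1)).
Proof.
move=> i_n; rewrite /rotation; case: eqP => [->|/eqP i0].
  case: n i_n => // m _; rewrite rot0 -[m.+1]addn1 iotaD map_cat cats1.
  by rewrite addn1; eexists.
case: i => // i in i_n i0 *.
rewrite /rot take_iota (minn_idPl (ltnW i_n)).
have -> : iota 0 i.+1 = rcons (iota 0 i) i by rewrite -addn1 iotaD cats1.
by rewrite -rcons_cat map_rcons; eexists.
Qed.

Lemma rotation_len i : (i < n)%N ->
  l (X i) - 2 * a - 2 * delta <= l (\prod_(x <- rotation i) x)%g.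
Proof.
move=> i_n; have := rotation_chain i; have [s ->] := rotation_head i_n.
by move=> /(chain_len_cons a0); have := len_ge0 l (\prod_(y <- s) y)%g; lra.
Qed.

Lemma rotation_separated i j : (i < n)%N -> (j < n)%N -> i != j ->
  gp (\prod_(x <- rotation i) x)%g (\prod_(x <- rotation j) x)%g
    <= a + 2 * delta.
Proof.
move=> i_n j_n ij; have := rotation_chain i; have := rotation_chain j.
have [s ->] := rotation_head i_n; have [s' ->] := rotation_head j_n => cj ci.
by apply: (chain_separated a0 ci cj); have [] := X_separated i_n j_n ij.
Qed.

Lemma rotation_separatedV i j : (i < n)%N -> (j < n)%N -> i != j ->
  gp (\prod_(x <- rotation i) x)^-1%g (\prod_(x <- rotation j) x)^-1%g
    <= a + 2 * delta.
Proof.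
move=> i_n j_n ij; rewrite -!prodg_rev_inv.
have := chainV (rotation_chain i); have := chainV (rotation_chain j).
have [s ->] := rotation_last i_n; have [s' ->] := rotation_last j_n.
rewrite !map_rcons !rev_rcons => cj ci; apply: (chain_separated a0 ci cj).
set i' := (if _ then _ else _); set j' := (if _ then _ else _).
have [] : [/\ (i' < n)%N, (j' < n)%N & i' != j'].
  rewrite /i' /j'; case: i j i_n j_n ij {ci cj i' j'} => [|i] [|j] /=;
  by split; lia.
by move=> i1 j1 ij1; have [] := X_separated i1 j1 ij1.
Qed.

End Rotations.

(** * Schottky words *)

Section SchottkyWords.
Context {R : realType} {T : groupType} {delta : R}.
Variable (l : @hyperbolic_length R T delta).
Context {S : {fset T}} {G : {pred T}}.
Hypothesis (G_group : group_closed G).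
Hypothesis (S_generates : generates S G).
Hypothesis (S_symmetric : [fset (s^-1)%g | s in S]%fset = S).
Hypothesis (S_large : (2 < #|` S|)%N).
Implicit Types (s t p q c : S) (w : seq S).
Local Notation gp := (gprod l).
Local Notation nb := (@nonbacktracking T S).

(** At most two of the letters are excluded. *)
Lemma connector q p : exists c, nb q c && nb c p.
Proof.
case: (fset_0Vmem (S `\` [fset (val q)^-1; (val p)^-1])%g%fset) => [S0|[x]].
  have : (#|` S| <= 2)%N.
    have /eqP := S0; rewrite fsetD_eq0 => /fsubset_leq_card /leq_trans; apply.
    by rewrite cardfs2; case: eqP.
  by rewrite leqNgt S_large.
rewrite in_fsetD in_fset2 negb_or => /andP[/andP[xq xp] xS].
exists [` xS]%fset; rewrite /nonbacktracking /= xq /=.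
by apply: contra xp => /eqP pE; rewrite -[x]invgK -pE.
Qed.

Definition path_word p c w :=
  exists r, [/\ w = p :: r, path nb p r & last p r = c].

Lemma path_word_cat p q q' c w w' : nb q q' ->
  path_word p q w -> path_word q' c w' -> path_word p c (w ++ w').
Proof.
move=> qq' [r [-> pr rq]] [r' [-> pr' <-]]; exists (r ++ q' :: r').
by rewrite cat_path last_cat /= pr pr' rq qq'.
Qed.

Lemma path_word_flatten p c (ws : seq (seq S)) : nb c p -> ws != [::] ->
  {in ws, forall w, path_word p c w} -> path_word p c (flatten ws).
Proof.
move=> cp; case: ws => // w ws _; elim: ws w => [|w' ws IHws] w wsP /=.
  by rewrite cats0; apply: wsP; rewrite inE.
apply: path_word_cat cp _ _; first by apply: wsP; rewrite inE eqxx.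
by apply: IHws => u uws; apply: wsP; rewrite inE uws orbT.
Qed.

Lemma word_val_cat w w' : word_val (w ++ w') = (word_val w * word_val w')%g.
Proof. exact: big_cat. Qed.

Lemma word_val_flatten (ws : seq (seq S)) :
  word_val (flatten ws) = (\prod_(x <- map (@word_val T S) ws) x)%g.
Proof.
elim: ws => [|w ws IHws] /=; first by rewrite /word_val !big_nil.
by rewrite word_val_cat big_cons IHws.
Qed.

(** Words of the same length with the same end letters can replace one another
    inside a nonbacktracking word. *)
Definition schottky_words C B n p q m (F : nat -> seq S) :=
  forall i, (i < n)%N ->
  [/\ path_word p q (F i), size (F i) = m, B <= l (word_val (F i)) &
    forall j, (j < n)%N -> i != j ->
      gp (word_val (F i)) (word_val (F j)) <= C /\
      gp (word_val (F i))^-1%g (word_val (F j))^-1%g <= C].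

(** Among sufficiently many Schottky elements [t j], enough are spelled by words
    with the same first letter [p] and the same last letter [q], and a single
    letter [c] joins any two of these words. For each [i], at most one [j] gives
    a bad corner between [t i] and [c * t j]; so a large subfamily has no bad
    corners, and the rotations of the product of its elements [t j * c] are
    chains with different ends. *)
Lemma exists_schottky_words f1 f2 n : (0 < n)%N ->
  f1 \in G -> f2 \in G ->
  straight l f1 -> straight l f2 -> transverse l f1 f2 ->
  exists C, forall B, exists p q m F, schottky_words C B n p q m F.
Proof.
move=> n0 f1G f2G s1 s2 f12; have d0 := delta_ge0 l.
pose J := (#|{: S * S}| * (n * n.+2)).+1.
have [C0 C0P] := schottky_elements J s1 s2 f12.
(* [D] bounds the lengths of all letters, and [a] the corners between the
   elements [t j * c]. *)
pose D := \sum_(s : S) l (val s).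
have lD s : l (val s) <= D.
  by rewrite /D (bigD1 s)//= lerDl sumr_ge0// => t _; exact: len_ge0.
have D0 : 0 <= D by apply: sumr_ge0 => t _; exact: len_ge0.
pose a : R := `|C0| + 3 * D + delta.
have C0a := (ler_norm C0, normr_ge0 C0).
have a0 : 0 <= a by rewrite /a; case: C0a; lra.
exists (a + 2 * delta) => B.
(* [B'] leaves room for the chain condition, for the letter [c] and for the
   final lower bound [B]. *)
pose B' : R := `|B| + 4 * a + 4 * delta + 1 + D.
have Bn := (ler_norm B, normr_ge0 B).
have [m' [n' tP]] := C0P B'.
pose t j := (f1 ^+ (j * n') * f2 ^+ m' * f1 ^- (j * n'))%g.
have {}tP j : (j < J)%N -> B' <= l (t j) /\
    forall k, (k < J)%N -> j != k ->
    gp (t j) (t k) <= C0 /\ gp (t j)^-1%g (t k)^-1%g <= C0 := tP j.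
have tG j : t j \in G.
  have fG k := group_closed_expg k G_group f1G.
  case: (G_group) => _; apply => //; apply: group_closedM => //.
  exact: group_closed_expg.
clearbody t.
have tne j : (j < J)%N -> t j != 1%g.
  move=> /tP[+ _]; apply: contraTneq => ->; rewrite len1 -ltNge /B'.
  by case: Bn; lra.
have /choice[W WP] : forall j, exists w, (j < J)%N -> exists p q,
    path_word p q w /\ word_val w = t j.
  move=> j.
  have [w wr wt] := reduced_word S_generates S_symmetric (tG j).
  exists w => jJ; case: w wr wt => [|p r] wr wt.
    by have := tne j jJ; rewrite -wt /word_val big_nil eqxx.
  by exists p, (last p r); split=> //; exists r.
have [js [p [q [us js_size jsJ jsP]]]] : exists (js : seq nat) p q,
    [/\ uniq js, (n * n.+2 <= size js)%N, {in js, forall j, (j < J)%N} &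
    {in js, forall j, path_word p q (W j) /\ word_val (W j) = t j}].
  have [s0 _] : exists s : S, True.
    have [p [_ _]] := WP 0 isT; by exists p.
  pose phi j : S * S := (head s0 (W j), last s0 (W j)).
  have [|[p q] pq] := @pigeonhole_filter _ _ phi (n * n.+2) (iota 0 J).
    by rewrite size_iota /J.
  exists [seq x <- iota 0 J | phi x == (p, q)], p, q; split.
  - exact/filter_uniq/iota_uniq.
  - exact: ltnW.
  - by move=> j; rewrite mem_filter mem_iota => /andP[_].
  move=> j; rewrite mem_filter mem_iota add0n => /andP[/eqP + /andP[_ /WP]].
  move=> [pE qE] [p' [q' [[r [Wr pr _]] Wt]]]; split=> //; exists r.
  by move: pE qE; rewrite Wr /= => <- <-.
have [c /andP[qc cp]] := connector q p.
pose bad : rel nat := fun i j => C0 + D + delta < gp (t i)^-1%g (val c * t j)%g.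
have [||ks [ks_size uks ksjs ksbad]] := @sparse_independent _ bad n js us.
- move=> i j k ijs jjs kjs; rewrite /bad => bij bik; apply/eqP/negPn/negP => jk.
  have := gprod_hyp l (val c * t j)%g (t i)^-1%g (val c * t k)%g.
  have := gprod_translate l (val c)^-1%g (val c * t j)%g (val c * t k)%g.
  have [_ /(_ k (jsJ k kjs) jk)[tjk _]] := tP j (jsJ j jjs).
  rewrite !mulKg lenV.
  by rewrite (gprodC l (val c * t j)%g (t i)^-1%g); have := lD c; lra.
- exact: js_size.
pose A i := rcons (W (nth 0 ks i)) c.
pose X i := (t (nth 0 ks i) * val c)%g.
have ks_mem i : (i < n)%N -> nth 0 ks i \in js.
  by move=> i_n; apply: ksjs; rewrite mem_nth// ks_size.
have ksJ i : (i < n)%N -> (nth 0 ks i < J)%N by move=> /ks_mem/jsJ.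
have AX i : (i < n)%N -> word_val (A i) = X i.
  move=> /ks_mem/jsP[_ Wt].
  by rewrite /A -cats1 word_val_cat Wt /word_val big_seq1.
have Apath i : (i < n)%N -> path_word p c (A i).
  move=> /ks_mem/jsP[Wp _]; rewrite /A -cats1; apply: path_word_cat qc Wp _.
  by exists [::].
have lX i : (i < n)%N -> B' - D <= l (X i).
  move=> /ksJ/tP[tB _].
  by have := lenM l (X i) (val c)^-1%g; rewrite mulgK lenV; have := lD c; lra.
have X_long i : (i < n)%N -> long l a (X i).
  by move=> /lX; rewrite /long /B'; case: Bn; lra.
have X_sep i j : (i < n)%N -> (j < n)%N -> i != j ->
  [/\ corner l a (X i) (X j), gp (X i) (X j) <= a &
      gp (X i)^-1%g (X j)^-1%g <= a].
  move=> i_n j_n ij.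
  have kij : nth 0 ks i != nth 0 ks j by rewrite nth_uniq ?ks_size.
  have [_ /(_ _ (ksJ j j_n) kij)] := tP _ (ksJ i i_n).
  have ksmem k : (k < n)%N -> nth 0 ks k \in ks.
    by move=> k_n; rewrite mem_nth// ks_size.
  have := ksbad _ _ (ksmem i i_n) (ksmem j j_n) kij; rewrite /bad -leNgt.
  rewrite /corner /X; set ti := t _; set tj := t _; set x := val c.
  move=> tx [tt' ttV].
  have lx : l x <= D := lD c.
  have := gprod_perturb l (x^-1 * ti^-1)%g (tj * x)%g (x^-1)%g.
  have := gprod_perturb l (ti * x)%g (tj * x)%g (x^-1)%g.
  have := gprod_perturbl l (ti * x)%g tj (x^-1)%g.
  have := gprod_translate l x (x^-1 * ti^-1)%g tj.
  have := gprod_translate l x (x^-1 * ti^-1)%g (x^-1 * tj^-1)%g.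
  rewrite !mulVKg !mulgK !invgM lenV; move: (len_ge0 l x).
  by rewrite /a; case: C0a => ? ?; split; lra.
pose F i := flatten [seq A k | k <- rot i (iota 0 n)].
have FX i : word_val (F i) =
    (\prod_(x <- [seq X k | k <- rot i (iota 0 n)]) x)%g.
  rewrite /F word_val_flatten -map_comp; congr (\big[_/_]_(x <- _) x).
  apply/eq_in_map => k; rewrite mem_rot mem_iota add0n => /andP[_].
  exact: AX.
exists p, c, (size (F 0)), F => i i_n; split.
- apply: path_word_flatten => //.
    by rewrite -size_eq0 size_map size_rot size_iota -lt0n.
  move=> w /mapP[k]; rewrite mem_rot mem_iota add0n => /andP[_ kn] ->.
  exact: Apath.
- apply: perm_size; apply: perm_flatten; apply: perm_map.
  by rewrite rot0 perm_rot.
- rewrite FX; have := rotation_len a0 X_long X_sep i_n; have := lX i i_n.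
  by rewrite /B'; case: Bn; lra.
move=> j j_n ij; rewrite !FX; split.
  exact: (rotation_separated a0 X_long X_sep).
exact: (rotation_separatedV a0 X_long X_sep).
Qed.
End SchottkyWords.

(** * Products of two Schottky blocks *)

Lemma sum_subsingleton {I : finType} (P : pred I) :
  (forall i j, P i -> P j -> i = j) -> (\sum_i P i <= 1)%N.
Proof.
move=> P1; rewrite -big_mkcond /= sum1_card.
by apply/card_le1_eqP => i j Pi Pj; exact: P1 Pj Pi.
Qed.

Section TwoBlocks.
Context {R : realType} {T : groupType} {delta : R}.
Variable (l : @hyperbolic_length R T delta).
Context {n : nat} (f : 'I_n -> T) (C : R).
Local Notation gp := (gprod l).
Hypothesis (C0 : 0 <= C).
Hypothesis (f_sep : forall i j, i != j ->
  gp (f i) (f j) <= C /\ gp (f i)^-1%g (f j)^-1%g <= C).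
Hypothesis (f_long : forall i, 4 * C + 10 * delta + 1 <= l (f i)).

(** Two elements close to [z] would be close to one another. *)
Lemma near_subsingleton (h : 'I_n -> T) z :
  (forall i j, i != j -> gp (h i) (h j) <= C) ->
  (\sum_i (C + delta < gp z (h i))%R <= 1)%N.
Proof.
move=> hC; apply: sum_subsingleton => i j zi zj; apply/eqP/negPn/negP => ij.
have := gprod_hyp l (h i) z (h j); have := hC i j ij.
by rewrite (gprodC l _ z); lra.
Qed.

(** The block [f i] is long, so [f i * v] starts in its direction. *)
Lemma gprod_block z i v : gp z (f i) <= C + delta ->
  gp (f i)^-1%g v <= C + delta -> gp z (f i * v)%g <= C + 2 * delta.
Proof.
move=> zi iv; have := gprod_hyp l z (f i * v)%g (f i).
have := delta_ge0 l; have := f_long i.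
by rewrite (gprodC l (f i * v)%g) gprod_mulr; have := C0; lra.
Qed.

(** The powers of the product are chains with alternating factors [f i * v] and
    [f j * v']. Keeping [v] and [v'] attached to the blocks allows them to be
    arbitrarily short or long. *)
Lemma two_blocks_linear_growth i j v v' :
  gp v (f i)^-1%g <= C + delta -> gp v' (f j)^-1%g <= C + delta ->
  gp (v^-1 * (f i)^-1)%g (f j) <= C + delta ->
  gp (v'^-1 * (f j)^-1)%g (f i) <= C + delta ->
  linear_growth l (f i * v * f j * v')%g.
Proof.
move=> vi vj ij ji; rewrite -mulgA; have [d0 c0] := (delta_ge0 l, C0).
rewrite gprodC in vi; rewrite gprodC in vj.
apply: (@linear_growth_mul _ _ _ l (C + 2 * delta)); first by lra.
- by rewrite /corner invgM; exact: gprod_block.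
- by rewrite /corner invgM; exact: gprod_block.
- by rewrite /long len_mul; have := len_ge0 l v; have := f_long i; lra.
- by rewrite /long len_mul; have := len_ge0 l v'; have := f_long j; lra.
Qed.

(** For each of the four conditions of [two_blocks_linear_growth], one of the
    indices can be fixed, and then at most one value of the other violates the
    condition. *)
Lemma two_blocks_count v v' :
  (\sum_i \sum_j ~~ `[< linear_growth l (f i * v * f j * v')%g >]
    <= 4 * n)%N.
Proof.
pose b x y : bool := C + delta < gp x y.
have b1 x (h : 'I_n -> T) : (forall i j, i != j -> gp (h i) (h j) <= C) ->
  (\sum_i b x (h i) <= 1)%N := @near_subsingleton h x.
have fC i j : i != j -> gp (f i) (f j) <= C by move=> /f_sep[].
have fVC i j : i != j -> gp (f i)^-1%g (f j)^-1%g <= C by move=> /f_sep[].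
have n1 (F : 'I_n -> nat) : (forall i, F i <= 1)%N -> (\sum_i F i <= n)%N.
  move=> F1; rewrite -[leqRHS]card_ord -sum1_card.
  by apply: leq_sum => i _; exact: F1.
apply: (@leq_trans (\sum_i \sum_j
  (b v (f i)^-1%g + b v' (f j)^-1%g + b (v^-1 * (f i)^-1)%g (f j)
    + b (v'^-1 * (f j)^-1)%g (f i)))%N).
  apply: leq_sum => i _; apply: leq_sum => j _; rewrite /b.
  do 4![case: ltP => ? /=; first by case: (~~ _)].
  by rewrite asboolT //; exact: two_blocks_linear_growth.
under eq_bigr => i _ do rewrite !big_split.
rewrite !big_split /= (_ : 4 * n = n + n + n + n)%N; last by lia.
rewrite !leq_add//.
- by rewrite exchange_big /=; apply: n1 => j; exact: b1.
- by apply: n1 => i; exact: b1.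
- by apply: n1 => i; exact: b1.
- by rewrite exchange_big /=; apply: n1 => j; exact: b1.
Qed.

End TwoBlocks.

(** * Averages over paths of a regular digraph *)

Section PathAverage.
Context {R : realType} {A : finType} (nb : rel A) (q : nat).
Hypothesis (q_gt0 : (0 < q)%N).
Hypothesis (nb_card : forall s, #|nb s| = q).
Implicit Types (s t : A) (x y w : seq A) (phi psi : seq A -> R).

(** The expectation of [phi] over [n] steps of the walk that starts at [s] and
    moves to a uniformly chosen [nb]-successor, each vertex having [q] of
    them. *)
Fixpoint path_avg s n phi : R :=
  if n is m.+1 then
    q%:R^-1 * \sum_(t | nb s t) path_avg t m (fun y => phi (t :: y))
  else phi [::].

Lemma path_avg_le s n phi psi : (forall y, phi y <= psi y) ->
  path_avg s n phi <= path_avg s n psi.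
Proof.
elim: n s phi psi => [|n IHn] s phi psi le_phi //=.
by rewrite ler_wpM2l ?invr_ge0// ler_sum// => t _; apply: IHn => y.
Qed.

Lemma path_avg_const s n a : path_avg s n (fun=> a) = a.
Proof.
elim: n s => [|n IHn] s //=; rewrite (eq_bigr (fun=> a))//.
rewrite sumr_const nb_card -[a *+ q]mulr_natl mulrA mulVf ?mul1r//.
by rewrite pnatr_eq0 -lt0n.
Qed.

Lemma path_avg_sum (I : finType) s n (F : I -> seq A -> R) :
  \sum_i path_avg s n (F i) = path_avg s n (fun y => \sum_i F i y).
Proof.
elim: n s F => [|n IHn] s F //=.
rewrite -mulr_sumr exchange_big /=; congr (_ * _).
by apply: eq_bigr => t _; exact: IHn.
Qed.

Lemma path_avgD s n phi psi : path_avg s n (fun y => phi y + psi y) =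
  path_avg s n phi + path_avg s n psi.
Proof.
elim: n s phi psi => [|n IHn] s phi psi //=.
rewrite -mulrDr -big_split /=; congr (_ * _).
by apply: eq_bigr => t _; exact: IHn.
Qed.

Lemma path_avgZ s n a phi :
  path_avg s n (fun y => phi y * a) = path_avg s n phi * a.
Proof.
elim: n s phi => [|n IHn] s phi //=; rewrite -mulrA; congr (_ * _).
by rewrite mulr_suml; apply: eq_bigr => t _; exact: IHn.
Qed.

Lemma path_avg_cat s m n phi : path_avg s (m + n) phi =
  path_avg s m (fun x => path_avg (last s x) n (fun y => phi (x ++ y))).
Proof.
elim: m s phi => [|m IHm] s phi //=; congr (_ * _).
by apply: eq_bigr => t _; exact: IHm.
Qed.

Lemma path_avg_word s x : path nb s x ->
  path_avg s (size x) (fun y => (y == x)%:R) = q%:R^-1 ^+ size x.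
Proof.
elim: x s => [|t x IHx] s //= /andP[st tx]; rewrite exprS; congr (_ * _).
rewrite (bigD1 t) //= [X in _ + X]big1 ?addr0.
  rewrite -(IHx t tx); congr path_avg; apply/funext => y.
  by rewrite eqseq_cons eqxx.
move=> u /andP[_ ut]; rewrite -[RHS](path_avg_const u (size x) 0).
by congr path_avg; apply/funext => y; rewrite eqseq_cons (negPf ut).
Qed.

Context {n m : nat} (X : 'I_n -> seq A) (s : A).
Hypothesis (X_inj : injective X).
Hypothesis (X_path : forall i, path nb s (X i)).
Hypothesis (X_size : forall i, size (X i) = m).

Lemma path_avg_words (a : 'I_n -> R) :
  path_avg s m (fun x => \sum_i (x == X i)%:R * a i) =
  q%:R^-1 ^+ m * \sum_i a i.
Proof.
rewrite -path_avg_sum mulr_sumr; apply: eq_bigr => i _.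
by rewrite path_avgZ -{1}(X_size i) path_avg_word// X_size.
Qed.

Lemma words_le1 : n%:R * q%:R^-1 ^+ m <= 1 :> R.
Proof.
have := path_avg_words (fun=> 1); rewrite sumr_const card_ord mulrC => <-.
rewrite -[leRHS](path_avg_const s m); apply: path_avg_le => x.
rewrite (eq_bigr (fun i => (x == X i)%:R)) => [|i _]; last by rewrite mulr1.
rewrite -natr_sum (_ : 1 = 1%:R)// ler_nat; apply: sum_subsingleton.
by move=> i j /eqP -> /eqP /X_inj.
Qed.

(** Each word [X i] has probability [q ^ -m], and [M] bounds [psi] on all other
    words. *)
Lemma path_avg_block psi M : (forall x, psi x <= M) ->
  path_avg s m psi <=
    (1 - n%:R * q%:R^-1 ^+ m) * M + q%:R^-1 ^+ m * \sum_i psi (X i).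
Proof.
move=> psiM; apply: le_trans (_ : _ <=
    path_avg s m (fun x => \sum_i (x == X i)%:R * (psi (X i) - M) + M)) _.
  apply: path_avg_le => x; have [[i xi]|nx] := pselect (exists i, x = X i).
    rewrite (bigD1 i)//= big1 => [|j ji]; last first.
      by rewrite xi (inj_eq X_inj) eq_sym (negPf ji) mul0r.
    by rewrite xi eqxx mul1r addr0 subrK.
  rewrite big1 ?add0r// => i _; case: eqP => [xi|]; last by rewrite mul0r.
  by case: nx; exists i.
rewrite path_avgD path_avg_const path_avg_words sumrB sumr_const card_ord.
by rewrite -mulr_natl; lra.
Qed.

End PathAverage.

(** * Resampling two blocks of a word *)

Section BlockEstimates.
Context {R : realType} {T : groupType} {S : {fset T}} (q : nat).
Local Notation nb := (@nonbacktracking T S).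
Local Notation avg := (@path_avg R S nb q).
Hypothesis (q_gt0 : (0 < q)%N).
Hypothesis (nb_card : forall s : S, #|nb s| = q).
Context {n m : nat} (F : 'I_n -> seq S) (p e : S) (link : S -> S).
Hypothesis (n_gt0 : (0 < n)%N).
Hypothesis (F_inj : injective F).
Hypothesis (F_path : forall i, path_word p e (F i)).
Hypothesis (F_size : forall i, size (F i) = m).
Hypothesis (link_nb : forall s, nb s (link s) && nb (link s) p).
Context (B : T -> R).
Hypothesis (B_le1 : forall x, B x <= 1).
Hypothesis (B_mulC : forall x y, B (x * y)%g = B (y * x)%g).
Hypothesis (B_blocks : forall v v',
  \sum_i \sum_j
    B (word_val (F i) * v * word_val (F j) * v')%g <= 4 * n%:R).

(** The letter [link s] makes every Schottky word available after every letter
    [s], with the same probability for all of them. *)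
Let block s i := link s :: F i.
(** The probability that the next [m.+1] letters form a block. *)
Let theta : R := n%:R * q%:R^-1 ^+ m.+1.

Let block_inj s : injective (block s).
Proof. by move=> i j [/F_inj]. Qed.

Let block_path s i : path nb s (block s i).
Proof.
rewrite /block; have [r [-> pr _]] := F_path i.
by have /andP[/= -> ->] := link_nb s.
Qed.

Let block_last s i : last s (block s i) = e.
Proof. by rewrite /block; have [r [-> _ <-]] := F_path i. Qed.

Let block_size s i : size (block s i) = m.+1.
Proof. by rewrite /= F_size. Qed.

Let avg_block s := @path_avg_block R _ _ _ q_gt0 nb_card _ _ _ _ (@block_inj s)
  (block_path s) (block_size s).

Lemma block_frequency_le1 (s : S) : theta <= 1.
Proof.
by have := @words_le1 R _ _ _ q_gt0 nb_card _ _ _ _ (@block_inj s)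
  (block_path s) (block_size s).
Qed.

Lemma word_val_block s i :
  word_val (block s i) = (val (link s) * word_val (F i))%g.
Proof. by rewrite /word_val /block big_cons. Qed.

(** The sum over [i] stands for a first block that is uniform among the [F i].
    At each of [k] attempts, the next letters form a second block with
    probability [theta], and then [B_blocks] applies; the last term accounts for
    the failure of all attempts. *)
Lemma second_block_avg k N s v u : (k * m.+1 <= N)%N ->
  \sum_i avg s N (fun y => B (word_val (F i) * v * word_val y * u)%g)
    <= 4 + n%:R * (1 - theta) ^+ k.
Proof.
have theta1 := block_frequency_le1 s.
elim: k N s v => [|k IHk] N s v kN.
  apply: (@le_trans _ _ (\sum_(i < n) 1)).
    apply: ler_sum => i _; rewrite -[leRHS](path_avg_const q_gt0 nb_card s N).
    exact: path_avg_le.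
  by rewrite sumr_const card_ord expr0 mulr1 lerDr.
have [N' NE kN'] : exists2 N', N = (m.+1 + N')%N & (k * m.+1 <= N')%N.
  by exists (N - m.+1)%N; move: kN; rewrite mulSn; lia.
rewrite {}NE.
under eq_bigr => i _ do rewrite path_avg_cat.
rewrite path_avg_sum.
apply: le_trans (avg_block s (M := 4 + n%:R * (1 - theta) ^+ k) _) _.
  move=> x; apply: le_trans (IHk N' (last s x) (v * word_val x)%g kN').
  apply: ler_sum => i _; apply: path_avg_le => y.
  by rewrite (word_val_cat x y) !mulgA.
(* Both blocks are now present, and the rest of the word is common. *)
have le4 : \sum_j \sum_i avg (last s (block s j)) N' (fun y =>
    B (word_val (F i) * v * word_val (block s j ++ y) * u)%g) <= 4 * n%:R.
  under eq_bigr => j _ do under eq_bigr => i _ do rewrite block_last.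
  under eq_bigr => j _ do rewrite path_avg_sum.
  rewrite path_avg_sum.
  rewrite -[leRHS](path_avg_const q_gt0 nb_card e N').
  apply: path_avg_le => y; rewrite exchange_big /=.
  apply: le_trans (B_blocks (v * val (link s)) (word_val y * u)).
  apply: ler_sum => i _; apply: ler_sum => j _.
  by rewrite (word_val_cat (block s j) y) word_val_block !mulgA.
have r0 : 0 <= q%:R^-1 ^+ m.+1 :> R by rewrite exprn_ge0// invr_ge0.
have := ler_wpM2l r0 le4; rewrite -/theta [(1 - theta) ^+ _.+1]exprS.
have -> : q%:R^-1 ^+ m.+1 * (4 * n%:R) = 4 * theta.
  by rewrite /theta mulrCA [_ * n%:R]mulrC.
by lra.
Qed.

(** The two powers of [1 - theta] bound the probabilities that a first, and then
    a second, block does not show up in time. If both do, [B_mulC] moves what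
    surrounds the blocks to their right, and averaging over the pair of blocks
    leaves [4 / n]. *)
Lemma two_blocks_avg k1 k2 N s u : ((k1 + k2) * m.+1 <= N)%N ->
  avg s N (fun y => B (u * word_val y)%g)
    <= 4 / n%:R + (1 - theta) ^+ k1 + (1 - theta) ^+ k2.
Proof.
have theta1 := block_frequency_le1 s.
have n0 : 0 < n%:R :> R by rewrite ltr0n.
elim: k1 N s u => [|k1 IHk] N s u kN.
  apply: (@le_trans _ _ 1).
    rewrite -[leRHS](path_avg_const q_gt0 nb_card s N).
    by apply: path_avg_le => y; exact: B_le1.
  have rk2 : 0 <= (1 - theta) ^+ k2 by rewrite exprn_ge0// subr_ge0.
  have n4 : 0 <= 4 / n%:R :> R by rewrite divr_ge0.
  by rewrite expr0; lra.
have [N' NE kN'] : exists2 N',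
    N = (m.+1 + N')%N & ((k1 + k2) * m.+1 <= N')%N.
  by exists (N - m.+1)%N; move: kN; rewrite addSn mulSn; lia.
have k2N' : (k2 * m.+1 <= N')%N.
  by apply: leq_trans kN'; rewrite leq_mul2r leq_addl orbT.
rewrite {}NE path_avg_cat.
apply: le_trans (avg_block s
  (M := 4 / n%:R + (1 - theta) ^+ k1 + (1 - theta) ^+ k2) _) _.
  move=> x; apply: le_trans (IHk N' (last s x) (u * word_val x)%g kN').
  by apply: path_avg_le => y; rewrite (word_val_cat x y) !mulgA.
have leB : \sum_j avg (last s (block s j)) N' (fun y =>
    B (u * word_val (block s j ++ y))%g) <= 4 + n%:R * (1 - theta) ^+ k2.
  apply: le_trans (second_block_avg e 1 (u * val (link s)) k2N').
  apply: ler_sum => j _; rewrite block_last; apply: path_avg_le => y.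
  rewrite (word_val_cat (block s j) y) word_val_block mulg1 !mulgA.
  by rewrite B_mulC !mulgA B_mulC !mulgA.
have r0 : 0 <= q%:R^-1 ^+ m.+1 :> R by rewrite exprn_ge0// invr_ge0.
have := ler_wpM2l r0 leB; rewrite -/theta [(1 - theta) ^+ _.+1]exprS.
set c := q%:R^-1 ^+ m.+1; set z := (1 - theta) ^+ k2.
have thetaE : theta = n%:R * c by [].
have -> : c * (4 + n%:R * z) = theta * (4 / n%:R + z).
  rewrite thetaE [n%:R * c]mulrC -mulrA; congr (_ * _).
  by rewrite mulrDr mulrCA divff ?mulr1// gt_eqF.
by lra.
Qed.

End BlockEstimates.

(** * Words without linear growth are rare *)

Section NonbacktrackingWords.
Context {R : realType} {T : groupType} {delta : R}.
Variable (l : @hyperbolic_length R T delta).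
Context {S : {fset T}} {G : {pred T}}.
Hypothesis (G_group : group_closed G).
Hypothesis (S_generates : generates S G).
Hypothesis (S_symmetric : [fset (s^-1)%g | s in S]%fset = S).
Local Notation nb := (@nonbacktracking T S).

Lemma card_nonbacktracking s : #|nb s| = #|` S|.-1.
Proof.
rewrite cardfE -(cardC1 [` letterV S_symmetric s]%fset).
by apply: eq_card => t; rewrite !inE.
Qed.

(** Otherwise the squares of all elements of [G] would commute. *)
Lemma straight_transverse_large f1 f2 : f1 \in G -> f2 \in G ->
  straight l f1 -> straight l f2 -> transverse l f1 f2 -> (2 < #|` S|)%N.
Proof.
move=> f1G f2G s1 s2 f12; rewrite ltnNge; apply/negP => S2.
have [n] := transverse_not_commute s1 s2 f12; apply; rewrite !expgnA.
by apply: (squares_commute S_generates S_symmetric S2);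
  exact: group_closed_expg.
Qed.

(** The number [K] of Schottky words is chosen first, to make [4 / K] small; it
    determines the words, hence [theta], and the waiting times come last. *)
Lemma nonbacktracking_linear_growth f1 f2 eps : f1 \in G -> f2 \in G ->
  straight l f1 -> straight l f2 -> transverse l f1 f2 -> 0 < eps ->
  exists N, forall n s u, (N <= n)%N ->
    @path_avg R S nb #|` S|.-1 s n
      (fun y => (~~ `[< linear_growth l (u * word_val y)%g >])%:R) <= eps.
Proof.
move=> f1G f2G s1 s2 f12 eps0.
have S_large := straight_transverse_large f1G f2G s1 s2 f12.
set q := #|` S|.-1; have q0 : (0 < q)%N by rewrite /q; lia.
pose K := (Num.truncn (4 / (eps / 3))).+1.
have K0 : 0 < K%:R :> R by rewrite ltr0n.
have Keps : 4 / K%:R <= eps / 3.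
  rewrite ler_pdivrMr// mulrC -ler_pdivrMr ?divr_gt0//.
  exact/ltW/truncnS_gt.
have [C CP] := exists_schottky_words G_group S_generates S_symmetric S_large
  (ltn0Sn _ : 0 < K)%N f1G f2G s1 s2 f12.
have [p [e [m [F FP]]]] := CP (4 * `|C| + 10 * delta + 1).
have d0 := delta_ge0 l.
have C0 : 0 <= `|C| := normr_ge0 C.
have CC : C <= `|C| := ler_norm C.
pose F' (i : 'I_K) := F i; pose f i := word_val (F' i).
have f_sep i j : i != j -> gprod l (f i) (f j) <= `|C| /\
    gprod l (f i)^-1%g (f j)^-1%g <= `|C|.
  move=> ij; have [_ _ _ /(_ j (ltn_ord j) ij)[? ?]] := FP i (ltn_ord i).
  by split; exact: le_trans CC.
have f_long i : 4 * `|C| + 10 * delta + 1 <= l (f i).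
  by have [_ _ + _] := FP i (ltn_ord i).
have F_inj : injective F'.
  move=> i j ij; apply/eqP/negPn/negP => /f_sep[+ _].
  have := f_long i; rewrite /f ij /gprod mulVg len1; lra.
have F_path i : path_word p e (F' i) by have [] := FP i (ltn_ord i).
have F_size i : size (F' i) = m by have [] := FP i (ltn_ord i).
have /choice[link link_nb] : forall s, exists c, nb s c && nb c p.
  by move=> s; exact: connector.
pose B x : R := (~~ `[< linear_growth l x >])%:R.
have B1 x : B x <= 1 by rewrite /B; case: (~~ _).
have BC x y : B (x * y)%g = B (y * x)%g.
  by rewrite /B; congr (~~ _)%:R; apply/asboolP/asboolP;
    exact: linear_growth_mulC.
have BB v v' : \sum_i \sum_j B (f i * v * f j * v')%g <= 4 * K%:R.
  have := two_blocks_count C0 f_sep f_long v v'.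
  rewrite -(ler_nat R) natrM natr_sum; under eq_bigr => i _ do rewrite natr_sum.
  by [].
have avg := two_blocks_avg q0 card_nonbacktracking (ltn0Sn _ : 0 < K)%N F_inj
  F_path F_size link_nb B1 BC BB.
set theta := K%:R * q%:R^-1 ^+ m.+1 in avg.
have theta1 : theta <= 1.
  exact: (block_frequency_le1 q0 card_nonbacktracking F_inj F_path F_size
    link_nb e).
have theta0 : 0 < theta.
  by rewrite mulr_gt0// exprn_gt0// invr_gt0 ltr0n.
have [k keps] : exists k, (1 - theta) ^+ k <= eps / 3.
  have r1 : `|1 - theta| < 1 by rewrite ger0_norm ?subr_ge0//; lra.
  have e3 : 0 < eps / 3 by rewrite divr_gt0.
  have /= [k _ kP] := cvgr_lt _ (cvg_expr r1) _ e3.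
  by exists k; exact/ltW/kP/leqnn.
exists ((k + k) * m.+1)%N => n s u kn.
by apply: le_trans (avg k k n s u kn) _; lra.
Qed.

End NonbacktrackingWords.

(** * The law of the walk *)

Section NonbacktrackingWalk.
Context {R : realType} {T : groupType} {S : {fset T}}.
Context {d : measure_display} {Omega : measurableType d}.
Context (P : probability Omega R) (g : nat -> Omega -> S).
Hypothesis (g_increments : nonbacktracking_increments P g).
Hypothesis (S_symmetric : [fset (s^-1)%g | s in S]%fset = S).
Local Notation nb := (@nonbacktracking T S).
Local Notation avg := (@path_avg R S nb #|` S|.-1).
Implicit Types (phi : pred (seq S)) (E : set Omega) (ns : seq nat).

Let letters ns w : seq S := [seq g i w | i <- ns].
Let past n (s : nat -> S) := [set w | forall i, (i <= n)%N -> g i w = s i].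

Lemma measurable_letters phi ns : measurable [set w | phi (letters ns w)].
Proof.
have [mg _ _] := g_increments; rewrite /letters.
elim: ns phi => [|i ns IHns] phi /=.
  by case: (phi [::]); rewrite (set_true, set_false).
rewrite (_ : [set w | _] = \bigcup_(t in [set: S]) ([set w | g i w = t] `&`
    [set w | phi (t :: letters ns w)])).
  apply: fin_bigcup_measurable => // t _; apply: measurableI; first exact: mg.
  exact: (IHns (fun y => phi (t :: y))).
by apply/seteqP; split=> [w pw|w [t _ [/= <-]]]; first by exists (g i w).
Qed.

Lemma measurable_past n s : measurable (past n s).
Proof.
have := measurable_letters (pred1 [seq s i | i <- iota 0 n.+1]) (iota 0 n.+1).
congr measurable; apply/seteqP; split=> [w /eqP/eq_in_map gs i i_n|w gs].
  by apply: gs; rewrite mem_iota.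
by apply/eqP/eq_in_map => i; rewrite mem_iota => /gs.
Qed.

Lemma probability_letter n E : measurable E ->
  P E = (\sum_(t : S) P (E `&` [set w | g n w = t]))%E.
Proof.
move=> mE; have [mg _ _] := g_increments.
rewrite {1}(_ : E = \bigcup_(t in [set: S]) (E `&` [set w | g n w = t])).
  rewrite content_fin_bigcup//=.
  - rewrite [RHS]fsbig_seq ?index_enum_uniq//; apply: eq_fsbigl.
    by apply/seteqP; split=> t //= _; rewrite mem_index_enum.
  - by move=> t u _ _ [w [[_ /= <-] [_ /= <-]]].
  - by move=> t _; exact: measurableI.
  apply: fin_bigcup_measurable => // t _; exact: measurableI.
by apply/seteqP; split=> [w Ew|w [t _ []//]]; exists (g n w).
Qed.

(** Every letter has the same number of allowed successors, so that given the
    past the next letters are distributed as in the path average. *)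
Lemma probability_future phi n k s :
  P (past k s `&` [set w | phi (letters (iota k.+1 n) w)]) =
  ((avg (s k) n (fun y => (phi y)%:R))%:E * P (past k s))%E.
Proof.
have [mg _ g_next] := g_increments.
elim: n k s phi => [|n IHn] k s phi.
  rewrite /letters /=; case: (phi [::]).
    by rewrite set_true setIT mul1e.
  by rewrite set_false setI0 measure0 mul0e.
rewrite (probability_letter k.+1); last first.
  by apply: measurableI; [exact: measurable_past|exact: measurable_letters].
(* The past, extended by the letter [t] at time [k.+1]. *)
pose s' t i := if (i <= k)%N then s i else t.
have pastS t : past k s `&` [set w | g k.+1 w = t] = past k.+1 (s' t).
  apply/seteqP; split=> [w [/= gs gt] i|w /= gs].
    rewrite leq_eqVlt ltnS => /predU1P[->|ik]; first by rewrite /s' ltnn.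
    by rewrite /s' ik; exact: gs.
  split=> [i ik|]; last by have := gs k.+1 (leqnn _); rewrite /s' ltnn.
  by have := gs i (leqW ik); rewrite /s' ik.
have next t : P (past k s `&` [set w | phi (letters (iota k.+1 n.+1) w)]
      `&` [set w | g k.+1 w = t]) =
    ((avg t n (fun y => (phi (t :: y))%:R) *
      (if nb (s k) t then #|` S|.-1%:R^-1 else 0))%:E * P (past k s))%E.
  rewrite setIAC pastS.
  rewrite (_ : _ `&` _ = past k.+1 (s' t) `&`
      [set w | phi (t :: letters (iota k.+2 n) w)]); last first.
    apply/seteqP; split=> w [/= pw]; have := pw k.+1 (leqnn _).
      by rewrite /s' ltnn => ->; split.
    by rewrite /letters /= => ->; rewrite /s' ltnn; split.
  rewrite (IHn _ _ (fun y => phi (t :: y))) {1}/s' ltnn -pastS g_next.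
  rewrite muleA -EFinM in_fsetD1 (valP t) andbT.
  have -> : #|` S `\ (val (s k))^-1%g|%fset = #|` S|.-1.
    by rewrite [in RHS](cardfsD1 (val (s k))^-1%g) letterV.
  by [].
under eq_bigr => t _ do rewrite next.
have pf : P (past k s) \is a fin_num.
  by apply: fin_num_measure; exact: measurable_past.
rewrite -(fineK pf); under eq_bigr => t _ do rewrite -EFinM.
rewrite sumEFin -EFinM -mulr_suml /=; congr ((_ * _)%:E).
rewrite mulr_sumr [RHS]big_mkcond; apply: eq_bigr => t _.
by case: ifP => _; rewrite ?mulr0// mulrC.
Qed.

Lemma walk_letters n w : walk g n w = word_val (letters (iota 0 n) w).
Proof.
by rewrite /walk /word_val big_map -(big_mkord xpredT (fun i => val (g i w)))
  /index_iota subn0.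
Qed.

Lemma measurable_walk (A : set T) n : measurable [set w | A (walk g n w)].
Proof.
have := measurable_letters (fun y => `[< A (word_val y) >]) (iota 0 n).
congr measurable; apply/seteqP.
by split=> w /=; rewrite walk_letters; move/asboolP.
Qed.

Lemma walk_probability_le (A : set T) n eps : (0 < #|` S|)%N ->
  (forall s, avg s n (fun y => (`[< A (val s * word_val y)%g >])%:R) <= eps) ->
  (P [set w | A (walk g n.+1 w)] <= eps%:E)%E.
Proof.
move=> S0 Aeps; have [mg g0 _] := g_increments.
pose phi (y : seq S) := `[< A (word_val y) >].
have AE : [set w | A (walk g n.+1 w)] = [set w | phi (letters (iota 0 n.+1) w)].
  by apply/seteqP; split=> w /=; rewrite walk_letters => /asboolP.
rewrite AE (probability_letter 0); last exact: measurable_letters.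
have first s : (P ([set w | phi (letters (iota 0 n.+1) w)] `&`
    [set w | g 0%N w = s]) <= (eps * #|` S|%:R^-1)%:E)%E.
  rewrite (_ : _ `&` _ = past 0 (fun=> s) `&`
      [set w | phi (s :: letters (iota 1 n) w)]); last first.
    apply/seteqP; split=> w [/=].
      by move=> pw gs; split=> [[|//] _|//]; rewrite -?gs.
    by move=> gs pw; have gs0 : g 0 w = s := gs 0 isT; rewrite gs0.
  rewrite (probability_future (fun y => phi (s :: y))).
  rewrite (_ : past 0 _ = [set w | g 0%N w = s]); last first.
    by apply/seteqP; split=> [w /(_ 0 isT)|w gs [|//]].
  rewrite g0 -EFinM lee_fin ler_wpM2r ?invr_ge0//.
  apply: le_trans (Aeps s); apply: path_avg_le => y.
  by rewrite /phi /word_val big_cons.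
apply: (@le_trans _ _ (\sum_(s : S) (eps * #|` S|%:R^-1)%:E)%E).
  exact: lee_sum.
rewrite sumEFin lee_fin sumr_const -[_ *+ #|_|]mulr_natr -mulrA -cardfE.
by rewrite mulVf ?mulr1// pnatr_eq0 -lt0n.
Qed.

End NonbacktrackingWalk.

(** * Convergence in probability *)

Theorem theorem2p8 (R : realType) (X : metricType R)
    (X_separable : separable_space X) (X_hyperbolic : hyperbolic_space X)
    (G : {pred Isom X}) (G_group : group_closed G)
    (G_nonelementary : nonelementary G)
    (S : {fset Isom X}) (S_generates : generates S G)
    (S_symmetric : [fset (s^-1)%g | s in S]%fset = S)
    (d : measure_display) (Omega : measurableType d)
    (P : probability Omega R) (g : nat -> Omega -> S)
    (g_increments : nonbacktracking_increments P g) :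
  P [set w | loxodromic (walk g n w)] @[n --> \oo] --> 1%E.
Proof.
have [delta fp] := hyperbolic_four_point X_hyperbolic.
have [a [b [aG bG lox_a lox_b ind]]] := G_nonelementary.
have [x _] := lox_a; pose l := orbit_length fp x.
have [i [j [s1 s2 f12]]] := independent_straight fp x lox_a lox_b ind.
have f1G := group_closed_expg i G_group aG.
have f2G := group_closed_expg j G_group bG.
have S_large := straight_transverse_large G_group S_generates S_symmetric
  f1G f2G s1 s2 f12.
pose lox := [set h : Isom X | loxodromic h].
have mlox n : measurable [set w | lox (walk g n w)].
  exact: (measurable_walk g_increments).
apply/fine_cvgP; split.
  by near=> n; apply: fin_num_measure; exact: mlox.
apply/cvgrPdist_le => /= eps eps0.
have [N NP] := nonbacktracking_linear_growth G_group S_generates S_symmetric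
  f1G f2G s1 s2 f12 eps0.
exists N.+1 => // -[//|n] /=; rewrite ltnS => Nn.
have : (P [set w | (~` lox) (walk g n.+1 w)] <= eps%:E)%E.
  apply: (walk_probability_le g_increments S_symmetric).
    by apply: leq_trans S_large.
  move=> s; apply: le_trans (NP n s (val s) Nn).
  apply: path_avg_le => y; rewrite (_ : `[< _ >] = ~~ `[< linear_growth l
    (val s * word_val y)%g >])//.
  by apply/asboolP/asboolPn => nl /(loxodromicP fp x).
have -> : [set w | (~` lox) (walk g n.+1 w)] = ~` [set w | lox (walk g n.+1 w)].
  by [].
rewrite probability_setC//.
have pf : P [set w | lox (walk g n.+1 w)] \is a fin_num.
  by apply: fin_num_measure; exact: mlox.
rewrite -(fineK pf) -EFinB lee_fin => le_eps; rewrite ger0_norm// subr_ge0.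
by rewrite -lee_fin fineK// probability_le1.
Unshelve. all: by end_near.
Qed.
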